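(* Let $r\ge 3$ be an integer and let $n\ge r+2$ be an integer. Let $\mathcal{H}$ be an $r$-graph on $n$ vertices with spectral radius $\lambda(\mathcal{H})$. (1) If $\lambda(\mathcal{H}) \ge \binom{n-2}{r-1}$, then $\mathcal{H}$ contains a Hamiltonian Berge path unless $\mathcal{H}\cong K_{n-1}^r+v$. (2) If $\lambda(\mathcal{H}) > \binom{n-2}{r-1}$, then $\mathcal{H}$ contains a Hamiltonian Berge cycle unless $\mathcal{H} \cong K_{n-1}^r + e$.
   Context: An $r$-graph ($r$-uniform hypergraph) $\mathcal{H}$ on $n$ vertices is a pair $(V,\mathcal{E})$ with $|V|=n$ and $\mathcal{E}\subseteq\binom{V}{r}$, where $\binom{V}{r}$ is the set of $r$-element subsets of $V$; elements of $\mathcal{E}=E(\mathcal{H})$ are called edges. Spectral radius: identify $V$ with $\{1,\dots,n\}$. For $\mathbf{x}=(x_1,\dots,x_n)\in\mathbb{R}^n$ let $P_{\mathcal{H}}(\mathbf{x}) = r\sum_{\{i_1,\dots,i_r\}\in E(\mathcal{H})} x_{i_1}\cdots x_{i_r}$. The spectral radius of $\mathcal{H}$ is $\lambda(\mathcal{H}) = \max_{\lVert\mathbf{x}\rVert_r=1}P_{\mathcal{H}}(\mathbf{x})$, the maximum over all $\mathbf{x}\in\mathbb{R}^n$ of $\ell_r$-norm $1$. A Berge cycle of length $\ell$ in an $r$-graph is a list of $\ell$ distinct edges $e_1,\dots,e_\ell$ and $\ell$ distinct vertices $v_1,\dots,v_\ell$ such that $v_i\in e_i\cap e_{i+1}$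 for $1\le i\le \ell-1$ and $v_\ell\in e_\ell\cap e_1$. A Berge path of length $\ell$ is the structure obtained from a Berge cycle of length $\ell$ by deleting one of the edges; that is, it consists of $\ell$ distinct vertices $v_1,\dots,v_\ell$ and $\ell-1$ distinct edges $e_1,\dots,e_{\ell-1}$ with $\{v_i,v_{i+1}\}\subseteq e_i$ for $1\le i\le \ell-1$. A Hamiltonian Berge cycle (resp. Hamiltonian Berge path) is a Berge cycle (resp. Berge path) whose vertices $v_1,\dots,v_\ell$ are all the vertices of the $r$-graph (so $\ell=n$). The complete $r$-graph $K_{m}^r$ on $m$ vertices has as edges all $r$-element subsets of its vertex set. $K_{n-1}^r+v$ denotes the $n$-vertex $r$-graph that is the disjoint union of $K_{n-1}^r$ and an isolated vertex $v$. $K_{n-1}^r+e$ denotes $K_{n-1}^r+v$ together with one additional edge $e$ containing $v$. The symbol $\cong$ denotes isomorphism of hypergraphs. *)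

(* Defs.v *)
From HB Require Import structures.
From mathcomp Require Import all_boot all_order all_algebra.
From mathcomp Require Import all_classical all_reals all_analysis.
Import Order.TTheory GRing.Theory Num.Theory.
Import numFieldNormedType.Exports.

Set Implicit Arguments.
Unset Strict Implicit.
Unset Printing Implicit Defensive.

Local Open Scope ring_scope.

Definition rsubsets (r : nat) (V : finType) : {set {set V}} :=
  [set e : {set V} | #|e| == r]%SET.

Record uhypergraph (r : nat) (V : finType) := UHypergraph {
  edges : {set {set V}};
  edges_uniform : edges \subset rsubsets r V }.

Definition uhypergraph_iso (r : nat) (V W : finType)
    (G : uhypergraph r V) (H : uhypergraph r W) : Prop :=
  exists2 f : V -> W, bijective f &
    forall e : {set V}, (e \in edges G) = ((f @: e)%SET \in edges H).

Section Constructions.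
Variable r : nat.

Definition complete_uhypergraph (V : finType) : uhypergraph r V :=
  UHypergraph (subxx (rsubsets r V)).

Lemma add_isolated_subproof (V : finType) (H : uhypergraph r V) :
  ((fun e : {set V} => Some @: e) @: edges H)%SET \subset rsubsets r (option V).
Proof.
apply/fintype.subsetP => _ /imsetP[e eH ->].
have := fintype.subsetP (edges_uniform H) _ eH.
by rewrite !inE card_imset//; exact: Some_inj.
Qed.

(* Disjoint union of [H] with one isolated vertex, namely [None]. *)
Definition add_isolated (V : finType) (H : uhypergraph r V) :
    uhypergraph r (option V) :=
  UHypergraph (add_isolated_subproof H).

Lemma add_edge_subproof (V : finType) (H : uhypergraph r V) (e : {set V}) :
  #|e| = r -> (e |: edges H)%SET \subset rsubsets r V.
Proof.
move=> er; apply/fintype.subsetP => f; rewrite in_setU1 => /predU1P[->|].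
  by rewrite inE er.
exact: (fintype.subsetP (edges_uniform H)).
Qed.

Definition add_edge (V : finType) (H : uhypergraph r V) (e : {set V})
    (er : #|e| = r) : uhypergraph r V :=
  UHypergraph (add_edge_subproof H er).

Definition complete_plus_vertex (m : nat) : uhypergraph r (option 'I_m) :=
  add_isolated (complete_uhypergraph 'I_m).

Definition iso_complete_plus_vertex (m : nat) (V : finType)
    (H : uhypergraph r V) : Prop :=
  uhypergraph_iso H (complete_plus_vertex m).

(* All choices of an [r]-set [e] containing the added vertex [None] give
   isomorphic [r]-graphs, so the existential picks out one isomorphism class. *)
Definition iso_complete_plus_edge (m : nat) (V : finType)
    (H : uhypergraph r V) : Prop :=
  exists (e : {set option 'I_m}) (er : #|e| = r),
    None \in e /\ uhypergraph_iso H (add_edge (complete_plus_vertex m) er).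

End Constructions.

Section Berge.
Variables (r : nat) (V : finType) (H : uhypergraph r V).

(* Indices are shifted to start at 0; [ordS] is the cyclic successor. *)
Definition Berge_cycle (l : nat) (v : 'I_l -> V) (e : 'I_l -> {set V}) : Prop :=
  [/\ injective v, injective e, forall i, e i \in edges H &
      forall i, v i \in (e i :&: e (ordS i))%SET].

(* [j] and [k] are the consecutive positions [i] and [i + 1], as elements of
   ['I_l] rather than of ['I_l.-1]. *)
Definition Berge_path (l : nat) (v : 'I_l -> V) (e : 'I_l.-1 -> {set V}) :
    Prop :=
  [/\ injective v, injective e, forall i, e i \in edges H &
      forall (i : 'I_l.-1) (j k : 'I_l), j = i :> nat -> k = i.+1 :> nat ->
        [set v j; v k]%SET \subset e i].

Definition has_Hamiltonian_Berge_cycle : Prop :=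
  exists (l : nat) (v : 'I_l -> V) (e : 'I_l -> {set V}),
    Berge_cycle v e /\ forall x : V, exists i, v i = x.

Definition has_Hamiltonian_Berge_path : Prop :=
  exists (l : nat) (v : 'I_l -> V) (e : 'I_l.-1 -> {set V}),
    Berge_path v e /\ forall x : V, exists i, v i = x.

End Berge.

Section SpectralRadius.
Variables (R : realType) (r : nat) (V : finType).
Implicit Types (H : uhypergraph r V) (x : V -> R).

Definition lr_norm x : R := (\sum_(i : V) `|x i| ^+ r) `^ (r%:R^-1).

Definition lagrangian_poly H x : R :=
  r%:R * \sum_(e in edges H) \prod_(i in e) x i.

(* The supremum is a maximum as soon as [0 < r] and [V] is nonempty: see
   [spectral_radius_max]. *)
Definition spectral_radius H : R :=
  sup [set lagrangian_poly H x | x in [set x | lr_norm x = 1]]%classic.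

Lemma lr_norm_eq1 x : (0 < r)%N ->
  lr_norm x = 1 <-> \sum_(i : V) `|x i| ^+ r = 1.
Proof.
move=> r0; rewrite /lr_norm; set s := \sum_i _.
have s0 : 0 <= s by apply: sumr_ge0 => i _; rewrite exprn_ge0.
have rN0 : r%:R != 0 :> R by rewrite pnatr_eq0 -lt0n.
split=> s1; last by rewrite s1 powR1.
by rewrite -(powRr1 s0) -[X in s `^ X](mulVf rN0) powRrM s1 powR1.
Qed.

Lemma spectral_radius_max H : (0 < r)%N -> (0 < #|V|)%N ->
  exists2 x, lr_norm x = 1 & spectral_radius H = lagrangian_poly H x /\
    forall y, lr_norm y = 1 -> lagrangian_poly H y <= lagrangian_poly H x.
Proof.
move=> r0 V0.
pose vec (u : 'rV[R]_#|V|) : V -> R := fun i => u ord0 (enum_rank i).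
pose row (x : V -> R) : 'rV[R]_#|V| := \row_j x (enum_val j).
have rowK x : vec (row x) = x.
  by apply/funext => i; rewrite /vec mxE enum_rankK.
have cvec i : continuous (fun u => vec u i) by exact: coord_continuous.
pose S (u : 'rV[R]_#|V|) : R := \sum_(i : V) `|vec u i| ^+ r.
have cS : continuous S.
  apply: continuous_big => [|i _ u]; first exact: add_continuous.
  apply: (@continuous_comp _ _ _ (fun u => `|vec u i|) (fun t => t ^+ r)).
    by apply: continuous_comp; [exact: cvec|exact: norm_continuous].
  exact: exprn_continuous.
have cP : continuous (fun u => lagrangian_poly H (vec u)).
  move=> u; apply: (@continuousM _ _ (cst r%:R)); first exact: cst_continuous.
  move: u; apply: continuous_big => [|e _]; first exact: add_continuous.
  by apply: continuous_big => [|i _]; [exact: mul_continuous|exact: cvec].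
pose A := [set u | S u = 1]%classic.
have A0 : (A !=set0)%classic.
  have [v _] := card_gt0P V0.
  exists (row (fun i => (i == v)%:R)); rewrite /A/= /S rowK (bigD1 v)//= eqxx.
  rewrite normr1 expr1n big1 ?addr0// => i /negbTE ->.
  by rewrite normr0 expr0n gtn_eqF.
have cA : compact A.
  apply: bounded_closed_compact; last first.
    apply: (@preimage_closed _ _ S [set 1]%classic) => [u _|]; first exact: cS.
    exact: closed_eq.
  exists 1; split=> // M M1 u Su.
  suff : mx_norm u <= M by [].
  rewrite mx_normrE; apply: bigmax_le => [|[i j] _/=].
    by rewrite (le_trans ler01)// ltW.
  apply: le_trans (ltW M1); rewrite leNgt; apply/negP => u1.
  have := Su; rewrite /A/= /S (bigD1 (enum_val j))//= => s1.
  have : 1 < `|vec u (enum_val j)| ^+ r.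
    by rewrite exprn_egt1 -?lt0n// /vec enum_valK; rewrite (ord1 i) in u1.
  rewrite -[in X in X < _]s1 gtrDl ltNge => /negP; apply.
  by apply: sumr_ge0 => k _; rewrite exprn_ge0.
have [u Au umax] := compact_EVT_max A0 cA (continuous_subspaceT cP).
have ymax y : lr_norm y = 1 ->
    lagrangian_poly H y <= lagrangian_poly H (vec u).
  by move=> /(lr_norm_eq1 y r0) y1; rewrite -{1}(rowK y); apply: umax;
    rewrite inE /A/= /S rowK.
have u1 : lr_norm (vec u) = 1 by apply/lr_norm_eq1 => //; move: Au; rewrite inE.
exists (vec u) => //; split=> //.
apply/eqP; rewrite eq_le; apply/andP; split.
  by apply: ge_sup; [exists (lagrangian_poly H (vec u)), (vec u)|
    move=> _ [y y1 <-]; exact: ymax].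
apply: ub_le_sup; last by exists (vec u).
by exists (lagrangian_poly H (vec u)) => _ [y y1 <-]; exact: ymax.
Qed.

End SpectralRadius.

(* Main.v *)
Require Import Defs.
From mathcomp Require Import all_boot zify.
Set Implicit Arguments.
Unset Strict Implicit.
Unset Printing Implicit Defensive.

(** The spectral hypothesis is turned into a lower bound for the number of
    edges; the rest of the proof is combinatorial.

    From the spectral radius to the number of edges ([spectral_card]). Let x be
    a nonnegative vector attaining the spectral radius lam. Choose an edge with
    probability proportional to the product of the x v over its vertices, list
    its vertices in random order as X_1, ..., X_r, and let D_i be the
    conditional entropy of X_i given X_1, ..., X_(i-1), minus ln (n - i).
    Because X_i and X_(i+1) are exchangeable and distinct,
    (n - i) D_i >= (n - i - 1) D_(i+1) ([pair_entropy], [entropy_concave]).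
    Gibbs' inequality gives D_2 + ... + D_r >= ln (lam / C(n-2,r-1))
    ([vertex_entropy]) and D_1 + ... + D_r <= ln (|E| / C(n-1,r))
    ([edge_entropy]). When lam >= C(n-2,r-1), the first sum is nonnegative, so
    the inequalities between consecutive D_i force D_1 >= 0
    ([concave_chain]), and therefore
    |E| / C(n-1,r) >= lam / C(n-2,r-1) >= 1.

    From the number of edges to a Hamiltonian Berge cycle
    ([uniform_hamiltonian]). A Berge cycle is a cycle of the bipartite incidence
    graph. An r-graph on n >= r + 2 vertices with more than C(n-1,r) edges and
    all degrees at least two has a Hamiltonian one, by induction on n. A vertex
    v of minimum degree d is deleted, which leaves more than C(n-2,r) edges. If
    all degrees remain at least two, there is a Hamiltonian cycle of the rest.
    For p and q in distinct edges at v, the cycle can be rerouted through v as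
    soon as a suitable edge contains the successors of p and q
    ([hamiltonian_insert]). If this never happens, many r-sets avoiding v are
    not edges; counting them shows that there are at least d, whereas the edge
    count allows fewer than d ([insert_vertex]). If some degree drops to one, the
    rest is a complete r-graph plus one edge at one further vertex w, and many
    edges contain both v and w ([pendant_hamiltonian]). For n = r + 2 each edge
    misses two vertices only, and a closure argument in the incidence graph
    applies ([hamiltonian_bond], [near_complete_hamiltonian]).

    A vertex of degree at most one forces the extremal r-graphs
    ([edges_Berge_cycle]). For paths, one r-set is added as an edge, the result
    on cycles is applied, and that edge is dropped again
    ([edges_Berge_path]). *)

(** * Hamiltonian cycles of an incidence relation *)

Section IncidenceCycles.
Variables V E : finType.
Implicit Types (I J : V -> E -> bool) (s t : seq (V + E)) (A : {set V}).

Definition incidence I : rel (V + E) := fun a b =>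
  match a, b with
  | inl x, inr e | inr e, inl x => I x e
  | _, _ => false
  end.

(** A Berge cycle is a cycle of the bipartite incidence graph: the alternation
    of vertices and edges supplies the distinct edges between consecutive
    vertices. *)
Definition hamiltonian A I := exists s,
  [/\ uniq s, cycle (incidence I) s & forall x, x \in A -> inl x \in s].

Lemma incidence_sym I : symmetric (incidence I).
Proof. by move=> [x|e] [y|f]. Qed.

Lemma rev_incidence_path I a s :
  path (incidence I) (last a s) (rev (belast a s)) = path (incidence I) a s.
Proof. by rewrite rev_path; apply: eq_path => b c; rewrite incidence_sym. Qed.

Lemma rev_incidence_cycle I s :
  cycle (incidence I) (rev s) = cycle (incidence I) s.
Proof. by rewrite rev_cycle; apply: eq_cycle => b c; rewrite incidence_sym. Qed.

Lemma next_vertex I s y : cycle (incidence I) s -> inl y \in s ->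
  exists2 f, next s (inl y) = inr f & I y f.
Proof.
by move=> cs ys; have := next_cycle cs ys; case: next => //= f; exists f.
Qed.

Lemma next_edge I s f : cycle (incidence I) s -> inr f \in s ->
  exists2 y, next s (inr f) = inl y & I y f.
Proof.
by move=> cs fs; have := next_cycle cs fs; case: next => //= y; exists y.
Qed.

Lemma prev_edge I s f : cycle (incidence I) s -> inr f \in s ->
  exists2 y, prev s (inr f) = inl y & I y f.
Proof.
by move=> cs fs; have := prev_cycle cs fs; case: prev => //= y; exists y.
Qed.

Lemma rotate_to_vertex I s p : uniq s -> cycle (incidence I) s -> inl p \in s ->
  exists e C, [/\ uniq [:: inl p, inr e & C],
    cycle (incidence I) [:: inl p, inr e & C],
    s =i [:: inl p, inr e & C] & next s =1 next [:: inl p, inr e & C]].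
Proof.
move=> us cs ps; have [i t Ht] := rot_to ps.
have nst : next s =1 next (inl p :: t) by move=> y; rewrite -Ht next_rot.
have mst : s =i inl p :: t by move=> y; rewrite -Ht mem_rot.
have := us; have := cs; rewrite -(rot_cycle i) -(rot_uniq i) Ht.
case: t {Ht} nst mst => [|[a|e] C] nst mst; rewrite ?[cycle _ _]/= ?andbF //.
by move=> ct ut; exists e, C.
Qed.

Lemma reverse_at I x a b (C : seq (V + E)) :
  let s := [:: x, a & rcons C b] in let s' := [:: x, b & rcons (rev C) a] in
  [/\ uniq s = uniq s', cycle (incidence I) s = cycle (incidence I) s' & s =i s'].
Proof.
move=> s s'; have rs : rotr 1 (rev s) = s'.
  by rewrite /s rev_cons rotr1_rcons rev_cons rev_rcons.
split; first by rewrite -rs rotr_uniq rev_uniq.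
  by rewrite -rs rotr_cycle rev_incidence_cycle.
by move=> y; rewrite -rs mem_rotr mem_rev.
Qed.

Lemma perm_two_cuts (T : eqType) (a b c d : T) (s t : seq T) :
  perm_eq [:: a, b & s ++ [:: c, d & t]] ([:: b; d; a; c] ++ s ++ t).
Proof. by apply/permP => P; rewrite /= !count_cat /=; lia. Qed.

Lemma subseq_two_cuts (T : eqType) (a b c d : T) (s t : seq T) :
  subseq (a :: s ++ c :: t) [:: a, b & s ++ [:: c, d & t]].
Proof.
apply: (@cat_subseq _ [:: a] (s ++ c :: t) [:: a; b]); first by rewrite /= eqxx.
apply: cat_subseq => //; apply: (@cat_subseq _ [:: c] t [:: c; d]) => //.
by rewrite /= eqxx.
Qed.

Lemma perm_insert (T : eqType) (a b c d e f : T) (s t : seq T) :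
  perm_eq ([:: a, b, c & rev t] ++ e :: s ++ [:: d; f])
    ([:: a; b; f; e] ++ c :: s ++ d :: t).
Proof. by apply/permP => P; rewrite /= !(count_cat, count_rev) /= !count_cat /=; lia. Qed.

(** Cutting the cycle after p and after q leaves two paths. One of them is
    reversed; they are joined at one end by h, which contains the successors of
    p and q, and at the other end through g, v and g'. The edges that followed
    p and q are freed, so h may be one of these two. *)
Lemma hamiltonian_insert A I v g g' h p q s :
    uniq s -> cycle (incidence I) s -> (forall x, x \in A -> inl x \in s) ->
    inl v \notin s -> inr g \notin s -> inr g' \notin s ->
    uniq [:: g; g'; h] -> I v g -> I v g' ->
    inl p \in s -> inl q \in s -> p != q -> I p g -> I q g' ->
    (forall z, next s (next s (inl p)) = inl z -> I z h) ->
    (forall z, next s (next s (inl q)) = inl z -> I z h) ->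
    (forall y, next s (inl y) = inr h -> y = p \/ y = q) ->
  hamiltonian (v |: A) I.
Proof.
move=> us cs As vs gs g's ugh vg vg' ps qs pq pg qg' nzp nzq nh.
have [e [C [ut ct st nt]]] := rotate_to_vertex us cs ps.
have qC : inl q \in C.
  have := qs; rewrite st !inE => /orP[/eqP[qp]|//].
  by rewrite qp eqxx in pq.
move: ut ct st nt; case/splitPr: C / qC => C1 [|[a|f] C2] ut ct st nt.
- by move: ct; rewrite /= rcons_cat cat_path /= !andbF.
- by move: ct; rewrite /= rcons_cat cat_path /= !andbF.
set s1 := [:: _, _ & _] in ut ct st nt.
pose s2 := [:: inl q, inr f & C2] ++ [:: inl p, inr e & C1] : seq (V + E).
have n2 : next s =1 next s2.
  by move=> y; rewrite nt -(next_rot (size [:: inl p, inr e & C1])) //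
    (rot_size_cat [:: _, _ & _]).
have np : next s (inl p) = inr e by rewrite nt /= eqxx.
have nq : next s (inl q) = inr f by rewrite n2 /= eqxx.
move: ct; rewrite /= rcons_cat cat_path /= => /and5P[pe eC1 eq1 qf].
rewrite -rev_incidence_path last_rcons belast_rcons rev_cons rcons_path.
case/andP=> C2p fC2.
have p1 := perm_two_cuts (inl p) (inr e) (inl q) (inr f) C1 C2.
have := ut; rewrite (perm_uniq p1) !cat_uniq has_cat negb_or.
case/and4P=> _ /andP[/hasPn n1 /hasPn n2'] u1 /andP[/hasPn n12 u2].
have nC x : x \notin s -> (x \notin C1) && (x \notin C2).
  by rewrite st (perm_mem p1) !mem_cat !negb_or => /andP[_].
have hC : (inr h \notin C1) && (inr h \notin C2).
  case: (boolP (inr h \in s)) => [hs|/nC//].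
  have [y hy _] := prev_edge cs hs.
  have ny : next s (inl y) = inr h by rewrite -hy next_prev.
  have hef : inr h \in ([:: inr e; inr f; inl p; inl q] : seq (V + E)).
    rewrite -ny; have [->|->] := nh y ny; rewrite ?np ?nq !in_cons eqxx //.
    by rewrite orbT.
  by apply/andP; split; apply/negP => /[dup]; [move/n1 | move/n2']; rewrite hef.
exists ([:: inl v, inr g, inl p & rev C2] ++ inr h :: C1 ++ [:: inl q; inr g']).
split.
- rewrite (perm_uniq (perm_insert _ _ _ _ _ _ _ _)).
  rewrite cat_uniq; apply/and3P; split.
  + by move: ugh; rewrite /= !inE.
  + apply/hasPn => x xC; rewrite !inE !negb_or.
    have xs : x != inr h -> x \in s.
      rewrite st (perm_mem p1); move: xC.
      rewrite !(inE, mem_cat) => /or4P[->|->|->|->]; rewrite ?orbT //.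
    have xh : x != inr h.
      apply: contraL xC => /eqP->; case/andP: hC => h1 h2.
      by rewrite !(inE, mem_cat) (negbTE h1) (negbTE h2).
    have {}xs := xs xh.
    by rewrite xh !andbT; apply/and3P; split; apply: contraTneq xs => ->.
  + exact: subseq_uniq (subseq_two_cuts _ _ _ _ _ _) ut.
- have h1 : incidence I (inr h) (head (inl q) C1).
    have := nzp (if C1 is inl z :: _ then z else q); rewrite np nt /s1.
    by case: (C1) eC1 => [|[z|//] t] /= _; rewrite !eqxx; apply.
  have h2 : incidence I (last (inl p) (rev C2)) (inr h).
    have := nzq (if C2 is inl z :: _ then z else p); rewrite nq n2 /s2.
    case: (C2) fC2 => [|[z|e'] t]; rewrite ?rev_cons ?last_rcons //= => _;
      by rewrite !eqxx; apply.
  rewrite /= vg pg rcons_cat cat_path C2p /= h2 rcons_cat cat_path /= qg' vg'.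
  by case: (C1) h1 eC1 eq1 => [|c t] /= -> //= /andP[_ ->] ->.
- move=> x; rewrite in_setU1 (perm_mem (perm_insert _ _ _ _ _ _ _ _)).
  case/orP=> [/eqP->|/As]; first by rewrite mem_head.
  rewrite st (perm_mem p1) !(inE, mem_cat) /=.
  by do ?[case/orP]; move=> ->; rewrite ?orbT.
Qed.

Lemma next_in_cycle (T : eqType) (a b : T) p1 p2 :
  uniq (p1 ++ [:: a, b & p2]) -> next (p1 ++ [:: a, b & p2]) a = b.
Proof.
move=> us; rewrite -(next_rot (size p1) us) rot_size_cat /=.
by rewrite eqxx.
Qed.

(** Ore's argument in a balanced bipartite graph: a cycle passing through the
    pair x, e is a path from x to e. By the degree condition some vertex y of
    this path is incident with e while the edge following y is incident with x;
    reversing the part of the path after y gives a cycle without that pair. *)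
Lemma hamiltonian_bond A (F : {set E}) I x e :
    1 < #|A| -> #|A| = #|F| -> (forall y f, I y f -> y \in A /\ f \in F) ->
    x \in A -> e \in F -> ~~ I x e ->
    #|A| < #|[set f | I x f]| + #|[set y | I y e]| ->
  hamiltonian A (fun y f => I y f || (y == x) && (f == e)) ->
  hamiltonian A I.
Proof.
set J := (X in hamiltonian A X -> _); move=> A1 AF IAF xA eF nIxe deg [s [us cs As]].
have JAF y f : J y f -> y \in A /\ f \in F.
  by case/orP=> [/IAF//|/andP[/eqP-> /eqP->]].
(* After a reversal if necessary, e does not follow x immediately. *)
have [f [C [us1 cs1 As1 fe]]] : exists f C, let s := [:: inl x, inr f & C] in
  [/\ uniq s, cycle (incidence J) s, forall y, y \in A -> inl y \in s & f != e].
  have [f [C [us1 cs1 ss1 _]]] := rotate_to_vertex us cs (As x xA).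
  have [fe|] := eqVneq f e; last first.
    by move=> fe; exists f, C; split=> // y /As; rewrite ss1.
  case/lastP: C us1 cs1 ss1 => [|C b] us1 cs1 ss1.
    have /subset_leq_card : A \subset [set x].
      apply/subsetP => y /As; rewrite ss1 !inE orbF => /eqP [->] //.
    by rewrite cards1 leqNgt A1.
  have [us2 cs2 ss2] := reverse_at J (inl x) (inr f) b C.
  rewrite {}us2 in us1; rewrite {}cs2 in cs1.
  have {ss1}ss2 y : (y \in s) = _ := etrans (ss1 y) (ss2 y).
  case: b us1 cs1 ss2 => [//|f1] us2 cs2 ss2.
  exists f1, (rcons (rev C) (inr f)); split=> // [y /As|]; first by rewrite ss2.
  move: us2; rewrite /= fe; case/and3P=> _; rewrite mem_rcons inE negb_or.
  by case/andP=> ne _ _; apply: contraNneq ne => ->.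
have xf : I x f.
  by move: cs1; rewrite /= => /andP[/orP[//|]]; rewrite (negbTE fe) andbF.
have IC : path (incidence I) (inr f) C.
  have : path (incidence J) (inr f) C.
    by move: cs1; rewrite /= rcons_path => /and3P[].
  apply: (@sub_in_path _ (predC1 (inl x))).
    move=> [a|a] [b|b] /= ax bx //; rewrite /J => /orP[//|/andP[/eqP ax' _]].
      by rewrite ax' inE eqxx in ax.
    by rewrite ax' inE eqxx in bx.
  move: us1; rewrite /= => /andP[]; rewrite inE negb_or => /andP[_ xC] _.
  by apply/allP => y yC; apply: contraNneq xC => <-.
have Il : incidence J (last (inr f) C) (inl x).
  by move: cs1; rewrite /= rcons_path => /and3P[].
have [le|le] := eqVneq (last (inr f) C) (inr e); last first.
  exists [:: inl x, inr f & C]; split=> //=.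
  rewrite xf rcons_path IC /=; case: (last _ _) le Il => //= a ae /orP[//|].
  by case/andP=> _ /eqP ae'; rewrite ae' eqxx in ae.
set s1 := [:: inl x, inr f & C] in us1 cs1 As1.
pose pi y := if next s1 (inl y) is inr g then g else e.
have piE y : y \in A -> next s1 (inl y) = inr (pi y) /\ pi y \in F.
  move=> yA; have [g yg] := next_vertex cs1 (As1 y yA).
  by rewrite /pi yg => /JAF[_].
have pi_inj : {in A &, injective pi}.
  move=> y z yA zA yz; have [ny _] := piE y yA; have [nz _] := piE z zA.
  have := can_inj (prev_next us1) (_ : next s1 (inl y) = next s1 (inl z)).
  by rewrite ny nz yz => /(_ erefl) [].
have piA : pi @: A = F.
  apply/eqP; rewrite eqEcard card_in_imset // AF leqnn andbT.
  by apply/subsetP => _ /imsetP[y /piE[_ ?] ->].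
(* The edges following the vertices of A make up F, so the degree of x is the
   number of vertices followed by an edge incident with x. *)
have [y yA /andP[xpy ye]] : exists2 y, y \in A & I x (pi y) && I y e.
  pose B := [set y in A | I x (pi y)].
  have cB : #|[set f | I x f]| <= #|B|.
    apply: leq_trans (leq_imset_card pi B); apply/subset_leq_card/subsetP => g.
    rewrite inE => xg; have : g \in pi @: A by rewrite piA; case/IAF: xg.
    by case/imsetP=> y yA gy; rewrite gy imset_f // inE yA -gy.
  pose C0 := [set y | I y e].
  have : B :&: C0 != set0.
    rewrite -card_gt0 -(ltn_add2l #|B :|: C0|) cardsUI addn0.
    apply: (@leq_ltn_trans #|A|); last by apply: leq_trans deg _; rewrite leq_add2r.
    apply/subset_leq_card/subsetP => y; rewrite !inE.
    by case/orP=> [/andP[]//|/IAF[]].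
  by case/set0Pn=> y; rewrite !inE => /andP[/andP[yA xy] ye]; exists y; rewrite ?xy.
have [ny _] := piE y yA; move: (pi y) xpy ny => g xg ny.
clear pi piE pi_inj piA.
have yC : inl y \in C.
  have := As1 y yA; rewrite !inE => /orP[/eqP[yx]|//].
  by rewrite -yx ye in nIxe.
move: us1 cs1 As1 IC le ny; rewrite {}/s1.
case/splitPr: C / yC {Il} => C1 [|h C2] us1 cs1 As1 IC le ny.
  by move: le; rewrite last_cat.
have hpi : h = inr g.
  by rewrite -ny (next_in_cycle (p1 := [:: inl x, inr f & C1])).
exists ([:: inl x, inr f & C1] ++ inl y :: rev (h :: C2)).
have ps : perm_eq ([:: inl x, inr f & C1] ++ inl y :: rev (h :: C2))
  [:: inl x, inr f & C1 ++ [:: inl y, h & C2]].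
  by rewrite !cat_cons !perm_cons perm_cat2l perm_cons perm_rev.
split.
- by rewrite (perm_uniq ps).
- move: IC le; rewrite cat_path last_cat /= => /and4P[C1p C1y _ hC2] le.
  rewrite (lastI h C2) rev_rcons le /= xf rcons_cat cat_path C1p /= C1y ye.
  rewrite rcons_path -le rev_incidence_path hC2.
  by case: (C2) => [|c C3]; rewrite /= ?rev_cons ?last_rcons hpi.
- by move=> z /As1; rewrite (perm_mem ps).
Qed.
End IncidenceCycles.

(** * Near-complete systems with as many edges as vertices *)

Section InterleavedCycle.
Variables V E : finType.
Implicit Types (I J : V -> E -> bool) (A : {set V}).

Definition interleave (s : seq V) (t : seq E) : seq (V + E) :=
  flatten [seq [:: inl p.1; inr p.2] | p <- zip s t].

Lemma perm_interleave s t : size s = size t ->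
  perm_eq (interleave s t) (map inl s ++ map inr t).
Proof.
move=> st; apply/permP => P; rewrite count_cat !count_map.
elim: s t st => [|x s IH] [|e t] //= [/IH]; rewrite /interleave /= => ->; lia.
Qed.

Lemma sub_hamiltonian A I J : (forall x e, I x e -> J x e) ->
  hamiltonian A I -> hamiltonian A J.
Proof.
move=> IJ [s [us cs As]]; exists s; split=> //.
by apply: sub_cycle cs => -[x|e] [y|f] //=; apply: IJ.
Qed.

Lemma hamiltonian_complete A (F : {set E}) : 0 < #|A| -> #|A| = #|F| ->
  hamiltonian A (fun x e => (x \in A) && (e \in F)).
Proof.
move=> A0 AF; exists (interleave (enum A) (enum F)).
have st : size (enum A) = size (enum F) by rewrite -!cardE.
have pe := perm_interleave st.
have inlI : injective (@inl V E) by move=> ? ? [].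
have inrI : injective (@inr V E) by move=> ? ? [].
split=> [||x xA].
- rewrite (perm_uniq pe) cat_uniq !map_inj_uniq // !enum_uniq andbT /=.
  by apply/hasPn => _ /mapP[e _ ->]; apply/mapP => -[].
- have: all (mem A) (enum A) by apply/allP => x; rewrite mem_enum.
  have: all (mem F) (enum F) by apply/allP => x; rewrite mem_enum.
  have : 0 < size (enum A) by rewrite -cardE.
  case: (enum A) (enum F) st => [|x s] [|e t] //= [st] _.
  case/andP=> eF tF /andP[xA sA]; rewrite /interleave /=.
  rewrite [x \in A]xA [e \in F]eF /= -/(interleave s t).
  elim: s t e st eF sA tF => [|y s IH] [|f t] //= e; first by rewrite [x \in A]xA => _ ->.
  case=> st eF /andP[yA sA] /andP[fF tF]; rewrite [y \in A]yA [e \in F]eF [f \in F]fF /=.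
  exact: IH.
- by rewrite (perm_mem pe) mem_cat map_f // mem_enum.
Qed.

End InterleavedCycle.

Section SquareSystems.
Variable V : finType.
Implicit Types (A U e : {set V}) (F : {set {set V}}).

Definition link F x := [set e in F | x \in e].

Definition avoiding F x := [set e in F | x \notin e].

Lemma card_avoiding F x : #|avoiding F x| + #|link F x| = #|F|.
Proof.
rewrite -cardsUI [_ :&: _](_ : _ = set0) ?cards0 ?addn0.
  apply: eq_card => e; rewrite !inE.
  by case: (x \in e); rewrite !(andbT, andbF, orbF).
by apply/setP => e; rewrite !inE; case: (x \in e); rewrite !andbF.
Qed.

Lemma bond_arith n k l m p q :
  l + m <= p -> k <= q -> k + 2 = n -> 2 < l + m -> n < p + q.
Proof. lia. Qed.

Lemma bond_arith1 n k l m p q :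
  l + m <= p -> k < q -> k + 2 = n -> 1 < l -> n < p + q.
Proof. lia. Qed.

Section Restrict.
Variables (A : {set V}) (F : {set {set V}}).
Hypothesis (A5 : 4 < #|A|) (AF : #|A| = #|F|).
Hypothesis FsubA : {in F, forall e, e \subset A}.
Hypothesis FA : {in F, forall e, #|A :\: e| = 2}.

(** Interpolates between the complete incidence relation (U empty) and the true
    one (U = A), so that vertices can be made to obey the true relation one at
    a time. *)
Definition restricted (U : {set V}) (x : V) (e : {set V}) :=
  [&& x \in A, e \in F & (x \in U) ==> (x \in e)].

(** The pairs formed by x and the edges avoiding it are removed one by one with
    [hamiltonian_bond]; every edge remains incident with at least |A| - 2
    vertices. If x has degree two, the last removal requires an edge incident
    with |A| - 1 vertices, that is, one whose other missing vertex is outside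
    U. *)
Lemma restrict_vertex U x : x \in A -> x \notin U ->
    1 < #|link F x| -> (2 < #|link F x|) || (#|U|.+2 < #|A|) ->
  hamiltonian A (restricted U) -> hamiltonian A (restricted (x |: U)).
Proof.
move=> xA xU d2 dU hU.
pose N := F :\: link F x.
pose J (D : {set {set V}}) y e := restricted (x |: U) y e || (y == x) && (e \in D).
(* e0 is the edge kept for the last removal when x has degree two. *)
have [e0 good0] : exists e0, (2 < #|link F x|) ||
    (e0 \in N) && [exists y in A :\: e0, (y != x) && (y \notin U)].
  have [d3|d2'] /= := ltnP 2 #|link F x|; first by exists set0.
  have cN : #|N| = #|A|.-2.
    rewrite cardsD (setIidPr _); last by apply/subsetP => e; rewrite inE => /andP[].
    by rewrite -AF; lia.
  move: dU; rewrite ltnNge d2' /= => U3.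
  apply/existsP; apply: contraLR U3 => /existsPn bad.
  have NU : N \subset [set A :\: [set x; y] | y in U].
    apply/subsetP => e eN; have := eN; rewrite !inE => /andP[xe eF].
    rewrite eF /= in xe; have := FA eF; have eA := FsubA eF.
    rewrite (cardsD1 x) !inE xe xA => -[] /eqP/cards1P[y Dy].
    have : y \in A :\: e :\ x by rewrite Dy inE.
    rewrite !inE => /and3P[yx ye yA].
    have yU : y \in U.
      apply: contraNT (bad e) => yU; rewrite eN /=; apply/existsP; exists y.
      by rewrite !inE ye yA yx yU.
    apply/imsetP; exists y => //; apply/setP => z.
    have : (z \in A :\: e :\ x) = (z \in [set y]) by rewrite Dy.
    rewrite !inE; have [->|zx] := eqVneq z x; first by rewrite (negbTE xe).
    case: (boolP (z \in A)) => [_ /= <-|zA _]; first by case: (z \in e).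
    by rewrite andbF; apply: contraNF zA; apply: (subsetP eA).
  have := leq_trans (subset_leq_card NU) (leq_imset_card _ _).
  by rewrite cN -leqNgt; clear; lia.
suff JH m (D : {set {set V}}) : #|D| = m -> D \subset N ->
    [|| 2 < #|link F x|, e0 \in D | D == set0] ->
    hamiltonian A (J D) -> hamiltonian A (restricted (x |: U)).
  apply: (JH #|N| N) => //.
    by case/orP: good0 => [->|/andP[-> _]]; rewrite ?orbT.
  apply: sub_hamiltonian hU => y e /and3P[yA eF yU].
  rewrite /J /restricted yA eF !inE eF /= andbT.
  by case: (eqVneq y x) => [->|] //=; rewrite ?orbF // orbN.
elim: m D => [|m IH] D cD DN eD hD.
  move/eqP: cD; rewrite cards_eq0 => /eqP D0.
  by apply: sub_hamiltonian hD => y e; rewrite /J D0 inE andbF orbF.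
have [e /and3P[eD' eD'' fine]] : exists e, [&& e \in D,
    [|| 2 < #|link F x|, e0 \in D :\ e | D :\ e == set0] &
    [|| 2 < #|link F x|, 0 < m | e == e0]].
  have D0 : 0 < #|D| by rewrite cD.
  case/or3P: eD => [d3|e0D|/eqP D0']; last by rewrite D0' cards0 in D0.
    by have [e eD] := card_gt0P D0; exists e; rewrite eD d3.
  case: m cD {IH} => [/eqP/cards1P[e De]|m cD].
    exists e0; rewrite e0D eqxx !orbT /=.
    by move: e0D; rewrite De inE => /eqP ->; rewrite setDv eqxx !orbT.
  have : 0 < #|D :\ e0| by move: (cardsD1 e0 D); rewrite e0D cD add1n => -[<-].
  case/card_gt0P=> e; rewrite 2!inE => /andP[ee0 eD].
  by exists e; rewrite eD !inE eq_sym ee0 e0D !orbT.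
have cDe : #|D :\ e| = m by have := cardsD1 e D; rewrite eD' cD => -[].
apply: (IH (D :\ e)) => //; first by apply: subset_trans DN; apply: subsetDl.
have /setDP[eF xe] := subsetP DN e eD'.
rewrite inE eF /= in xe.
apply: (@hamiltonian_bond V _ A F _ x e) => //.
- exact: leq_trans A5.
- move=> y f /orP[/and3P[]//|/andP[/eqP-> /setD1P[_ /(subsetP DN)]]].
  by move=> /setDP[].
- by rewrite /J /restricted !inE !eqxx (negbTE xe) /= !andbF.
- pose Y := [set y | J (D :\ e) y e].
  have cX : #|link F x| + m <= #|[set f | J (D :\ e) x f]|.
    rewrite -cDe -cardsUI -[leqRHS]addn0; apply: leq_add; last first.
      rewrite leqn0 cards_eq0 -subset0; apply/subsetP => f.
      rewrite !inE => /andP[/andP[fF xf] /andP[_ /(subsetP DN)]].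
      by rewrite !inE fF xf.
    apply/subset_leq_card/subsetP => f; rewrite !inE /J /restricted !inE eqxx xA /=.
    by case/orP=> [/andP[-> ->]|->]; rewrite ?orbT.
  have cY : #|A :&: e| <= #|Y|.
    apply/subset_leq_card/subsetP => y; rewrite !inE /J /restricted => /andP[-> ye].
    by rewrite eF ye implybT.
  have cAe : #|A :&: e| + 2 = #|A| by rewrite -(FA eF) cardsID.
  have [lm|] := ltnP 2 (#|link F x| + m); first exact: bond_arith cX cY cAe lm.
  case/or3P: fine => [d3|m0|/eqP ee0].
  + by rewrite leqNgt (leq_trans d3 (leq_addr _ _)).
  + by rewrite leqNgt -addn1 (leq_add d2 m0).
  + rewrite leqNgt => /negP lm.
    have [d3|d2'] := ltnP 2 #|link F x|; first by case: lm; apply: leq_trans (leq_addr _ _).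
    move: good0; rewrite ltnNge d2' /= -ee0 => /andP[_].
    case/existsP=> y; rewrite !inE => /andP[/andP[ye yA] /andP[yx yU]].
    have cY' : #|A :&: e| < #|Y|.
      apply: proper_card; apply/properP; split.
        apply/subsetP => z; rewrite !inE /J /restricted => /andP[-> ze].
        by rewrite eF ze implybT.
      exists y; last by rewrite inE (negbTE ye) andbF.
      by rewrite inE /J /restricted yA eF !inE (negbTE yx) (negbTE yU).
    exact: bond_arith1 cX cY' cAe d2.
- apply: sub_hamiltonian hD => y f; rewrite /J !inE.
  case/orP=> [->//|/andP[-> fD]].
  by rewrite fD /= andbT; case: eqVneq; rewrite ?orbT.
Qed.

(** Each edge misses two vertices, hence there are 2 |A| missing incidences in
    all, fewer than |A| - 1 vertices of degree at most two would produce. *)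
Lemma two_large_links : 1 < #|[set x in A | 2 < #|link F x|]|.
Proof.
rewrite ltnNge; apply/negP => B1.
set B := [set x in A | _] in B1.
have eqs : \sum_(x in A) #|avoiding F x| = #|A| * 2.
  transitivity (\sum_(x in A) \sum_(e in F) (x \notin e : nat)).
    apply: eq_bigr => x _; rewrite -sum1_card big_mkcond /=.
    rewrite [RHS]big_mkcond; apply: eq_bigr => e _; rewrite inE.
    by case: (e \in F); case: (x \in e).
  rewrite exchange_big /= AF -sum_nat_const; apply: eq_bigr => e eF.
  rewrite -(FA eF) -sum1_card [RHS]big_mkcond /= big_mkcond /=.
  by apply: eq_bigr => x _; rewrite !inE; case: (x \in A); case: (x \in e).
have : #|A :\: B| * (#|A| - 2) <= #|A| * 2.
  rewrite -eqs -sum_nat_const [leqRHS](big_setID B) /=.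
  apply: leq_trans (leq_addl _ _); apply: leq_sum => x.
  rewrite !inE => /andP[xB xA]; rewrite xA -leqNgt in xB.
  by rewrite leq_subLR AF -(card_avoiding F x) [2 + _]addnC leq_add2l.
have := cardsD A B; rewrite (setIidPr _); last first.
  by apply/subsetP => x; rewrite inE => /andP[].
clear -A5 B1; nia.
Qed.

(** The two vertices of degree at least three are restricted last, because a
    vertex of degree two can only be restricted while U is small. *)
Lemma near_complete_hamiltonian :
  {in A, forall x, 1 < #|link F x|} ->
  hamiltonian A (fun x e => (e \in F) && (x \in e)).
Proof.
move=> d2; have /card_gt1P[x1 [x2 [/setIdP[x1A d1] /setIdP[x2A d2'] x12]]] :=
  two_large_links.
suff h U : U \subset A :\ x1 :\ x2 -> hamiltonian A (restricted U).
  have := h _ (subxx _).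
  move/(restrict_vertex x2A); rewrite !inE eqxx d2 // d2' /= => /(_ isT isT isT).
  move/(restrict_vertex x1A); rewrite !inE eqxx (negbTE x12) d2 // d1 /=.
  move=> /(_ isT isT isT); apply: sub_hamiltonian => x e /and3P[xA -> /=].
  by move/implyP; apply; rewrite !inE xA; case: (x == x1); case: (x == x2).
move En : #|U| => n; elim: n U En => [|n IH] U cU UA.
  have A0 : 0 < #|A| by apply: leq_trans A5.
  apply: sub_hamiltonian (hamiltonian_complete A0 AF) => x e /andP[xA eF].
  by move/eqP: cU; rewrite cards_eq0 => /eqP ->; rewrite /restricted xA eF inE.
have /card_gt0P[x xU] : 0 < #|U| by rewrite cU.
have cUx : #|U :\ x| = n by move: (cardsD1 x U); rewrite xU cU => -[].
have xA : x \in A by move/(subsetP UA): xU; rewrite !inE => /and3P[].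
rewrite -(setD1K xU); apply: restrict_vertex => //.
- by rewrite !inE eqxx.
- exact: d2.
- apply/orP; right; have := subset_leq_card UA.
  have := cardsD1 x1 A; rewrite x1A; have := cardsD1 x2 (A :\ x1).
  rewrite !inE x2A eq_sym x12 cU cUx /=; clear; lia.
- by apply: IH => //; apply: subset_trans UA; apply: subsetDl.
Qed.
End Restrict.
End SquareSystems.

(** * Pairs of points in distinct members of a family *)

Section Spread.
Variable V : finType.
Implicit Types (S g : {set V}) (L : {set {set V}}).

Definition spread_pair L (x y : V) :=
  [exists g in L, exists h in L, [&& g != h, x \in g & y \in h]].

Definition spread L S :=
  [exists x in S, exists y in S, (x != y) && spread_pair L x y].

Lemma spread_pairP L x y : reflect
  (exists g h, [/\ g \in L, h \in L, g != h, x \in g & y \in h])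
  (spread_pair L x y).
Proof.
apply: (iffP exists_inP) => [[g gL /exists_inP[h hL /and3P[gh xg yh]]]|].
  by exists g, h.
move=> [g [h [gL hL gh xg yh]]]; exists g => //; apply/exists_inP.
by exists h; rewrite // gh xg.
Qed.

Lemma spreadP L S : reflect
  (exists x y, [/\ x \in S, y \in S, x != y & spread_pair L x y])
  (spread L S).
Proof.
apply: (iffP exists_inP) => [[x xS /exists_inP[y yS /andP[xy sxy]]]|].
  by exists x, y.
move=> [x [y [xS yS xy sxy]]]; exists x => //; apply/exists_inP.
by exists y; rewrite // xy.
Qed.

(** Two covered points fail to be spread exactly when both lie in one and the
    same single member of L. This is an equivalence relation; the lemma is its
    transitivity. *)
Lemma spread_pair_split L x y z : z \in cover L ->
  spread_pair L x y -> spread_pair L x z \/ spread_pair L z y.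
Proof.
case/bigcupP=> k kL zk /spread_pairP[g [h [gL hL gh xg yh]]].
have [kg|kg] := eqVneq k g.
  by right; apply/spread_pairP; exists g, h; rewrite -kg in gL gh *.
by left; apply/spread_pairP; exists g, k; rewrite eq_sym.
Qed.

Lemma spread_large L S k : {in L, forall g, #|g| <= k} ->
  S \subset cover L -> k < #|S| -> spread L S.
Proof.
move=> Lk SL kS; have /card_gt0P[x xS] : 0 < #|S| by apply: leq_trans kS.
have /bigcupP[g gL xg] := subsetP SL x xS.
have /subsetPn[y yS yg] : ~~ (S \subset g).
  by apply/negP => /subset_leq_card; rewrite leqNgt (leq_ltn_trans (Lk g gL)).
have /bigcupP[h hL yh] := subsetP SL y yS.
apply/spreadP; exists x, y; split=> //; first by apply: contraNneq yg => <-.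
by apply/spread_pairP; exists g, h; split=> //; apply: contraNneq yg => ->.
Qed.

(** A member without a spread pair is disjoint from all the other members. Fix
    such an isolated member g0 and a point x0 in it. Every other isolated
    member trades one of its points for x0, and g0 trades x0 for a point
    outside it; all other members are kept. *)
Lemma spread_inj L k : 1 < k -> {in L, forall g, #|g| = k} -> 1 < #|L| ->
  exists2 phi : {set V} -> {set V}, {in L &, injective phi} &
    {in L, forall g, [/\ phi g \subset cover L, #|phi g| = k & spread L (phi g)]}.
Proof.
move=> k1 Lk L1.
have [allS|] := boolP [forall g in L, spread L g].
  exists id => [//|g gL]; split; [exact: bigcup_sup|exact: Lk|].
  by have /forall_inP := allS; exact.
rewrite negb_forall_in => /exists_inP[g0 g0L ns0].
pose iso g := ~~ spread L g.
have isoE g h x : g \in L -> h \in L -> iso g -> x \in g -> x \in h -> g = h.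
  move=> gL hL ig xg xh; apply/eqP; apply: contraNT ig => gh.
  have /card_gt0P[y] : 0 < #|g :\ x|.
    by have := cardsD1 x g; rewrite xg Lk //; lia.
  rewrite !inE => /andP[yx yg]; apply/spreadP; exists y, x; split=> //.
  by apply/spread_pairP; exists g, h.
have pickg g : g \in L -> {x | x \in g}.
  by move=> gL; apply/sigW/card_gt0P; rewrite Lk //; lia.
have [x0 x0g] := pickg g0 g0L.
have /card_gt0P[g1] : 0 < #|L :\ g0| by have := cardsD1 g0 L; rewrite g0L; lia.
rewrite !inE => /andP[g10 g1L].
have [z0 z0g] := pickg g1 g1L.
have z0n : z0 \notin g0.
  by apply: contra g10 => z0g0; rewrite (isoE g0 g1 z0).
pose c g := odflt x0 [pick x in g].
have cg g : g \in L -> c g \in g.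
  move=> gL; rewrite /c; case: pickP => //= none.
  by have [x] := pickg g gL; rewrite none.
pose phi g := if g == g0 then z0 |: (g0 :\ x0)
  else if iso g then x0 |: (g :\ c g) else g.
have rest g x : g \in L -> x \in g -> exists2 y, y \in g & y != x.
  move=> gL xg; have /card_gt0P[y] : 0 < #|g :\ x|.
    by have := cardsD1 x g; rewrite xg Lk //; lia.
  by rewrite !inE => /andP[]; exists y.
have x0n g : g \in L -> g != g0 -> x0 \notin g.
  by move=> gL; apply: contra => x0g'; rewrite (isoE g0 g x0).
have sub g : g \in L -> g \subset cover L by move=> gL; apply: bigcup_sup.
have x0phi g : g \in L -> g != g0 -> iso g -> phi g = x0 |: (g :\ c g).
  by move=> gL gg0 ig; rewrite /phi (negbTE gg0) ig.
have phi0 : phi g0 = z0 |: (g0 :\ x0) by rewrite /phi eqxx.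
have phin g : g != g0 -> ~~ iso g -> phi g = g.
  by move=> gg0 ig; rewrite /phi (negbTE gg0) (negbTE ig).
have x0n0 : x0 \notin phi g0.
  by rewrite phi0 !inE eqxx orbF; apply: contraNneq z0n => <-.
have inj0 h : h \in L -> h != g0 -> phi g0 != phi h.
  move=> hL hg0; case: (boolP (iso h)) => ih.
    by apply: contraNneq x0n0 => ->; rewrite x0phi // !inE eqxx.
  have [y yg yx] := rest g0 x0 g0L x0g.
  rewrite (phin h) // phi0; apply: contraNneq hg0 => gh; apply/eqP/esym.
  by apply: (isoE _ _ y) => //; rewrite -gh !inE yx yg orbT.
have injn g h : g \in L -> h \in L -> g != g0 -> h != g0 -> iso g ->
    phi g = phi h -> g = h.
  move=> gL hL gg0 hg0 ig gh; have [y yg yc] := rest g (c g) gL (cg g gL).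
  have : y \in phi h by rewrite -gh x0phi // !inE yg yc orbT.
  case: (boolP (iso h)) => ih; last by rewrite phin //; apply: isoE.
  rewrite x0phi // !inE => /predU1P[yx0|/andP[_ yh]]; last exact: isoE yg yh.
  by rewrite yx0 (negbTE (x0n g gL gg0)) in yg.
exists phi.
  move=> g h gL hL; have [->|gg0] := eqVneq g g0; have [->|hg0] := eqVneq h g0 => //.
  - by move/eqP; rewrite (negbTE (inj0 h hL hg0)).
  - by move/esym/eqP; rewrite (negbTE (inj0 g gL gg0)).
  case: (boolP (iso g)) => ig; first exact: injn.
  case: (boolP (iso h)) => ih; first by move/esym/injn => ->.
  by rewrite !phin.
move=> g gL; rewrite /phi; have [_|gg0] := eqVneq g g0.
  split.
  - rewrite subUset sub1set (subsetP (sub g1 g1L)) //=.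
    by apply: subset_trans (sub g0 g0L); apply: subsetDl.
  - have := cardsD1 x0 g0; rewrite cardsU1 !inE (negbTE z0n) andbF x0g.
    by rewrite (Lk g0) // => ->.
  - have [y yg yx] := rest g0 x0 g0L x0g.
    apply/spreadP; exists y, z0; rewrite !inE eqxx yx yg orbT; split=> //.
      by apply: contraNneq z0n => <-.
    by apply/spread_pairP; exists g0, g1; rewrite eq_sym.
case: ifP => [ig|/negbFE sg]; last by split; [exact: sub|exact: Lk|].
split.
- rewrite subUset sub1set (subsetP (sub g0 g0L)) //=.
  by apply: subset_trans (sub g gL); apply: subsetDl.
- have := cardsD1 (c g) g; rewrite cardsU1 !inE (negbTE (x0n g gL gg0)) andbF.
  by rewrite cg // (Lk g) // => ->.
- have [y yg yx] := rest g (c g) gL (cg g gL).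
  apply/spreadP; exists y, x0; rewrite !inE eqxx yx yg orbT; split=> //.
    by apply: contraNneq (x0n g gL gg0) => <-.
  by apply/spread_pairP; exists g, g0.
Qed.

End Spread.

(** * Inserting a vertex into a Hamiltonian cycle *)

Lemma insert_arith b d k c : c < k + d -> 1 < d -> 0 < b -> k <= c ->
  d * b < c - k + b -> False.
Proof.
case: d => [|d] //; case: b => [|b] // ckd _ _ kc; rewrite mulSn.
have : d <= d * b.+1 by rewrite leq_pmulr.
by move: (d * b.+1) => x; lia.
Qed.

Section Insert.
Variable V : finType.
Implicit Types (A S T e : {set V}) (F : {set {set V}}).

Definition incident F (x : V) e := (e \in F) && (x \in e).

(** Let N be the set of neighbours of v, d its degree, and tau the successor map
    on the cycle through the other vertices A'. If v cannot be inserted, then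
    for an r-set S such that S meets N in a spread pair, the set tau(S) is an
    edge only if it follows a vertex outside N on the cycle. Hence all but
    at most |A' - N| of these images are non-edges avoiding v, and there are
    fewer than d such non-edges. But there are more than d |A' - N| sets S: the sets given
    by [spread_inj] extended by a vertex outside N, and an r-subset of N. *)
Lemma insert_vertex A F v r :
    2 < r -> {in F, forall e, e \subset A} -> {in F, forall e, #|e| = r} ->
    v \in A -> 1 < #|link F v| ->
    'C(#|A :\ v|, r) < #|avoiding F v| + #|link F v| ->
  hamiltonian (A :\ v) (incident (avoiding F v)) -> hamiltonian A (incident F).
Proof.
move=> r2 FA Fr vA d2 dense [s [us cs0 As]].
set A' := A :\ v in dense As; set F' := avoiding F v in dense cs0.
have cs : cycle (incidence (incident F)) s.
  apply: sub_cycle cs0 => -[x|e] [y|f] //=;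
  by rewrite /incident inE => /andP[/andP[-> _] ->].
have F'A e : e \in F' -> e \subset A'.
  rewrite inE => /andP[eF ve]; apply/subsetP => x xe; rewrite !inE.
  by rewrite (subsetP (FA e eF) x xe) andbT; apply: contraNneq ve => <-.
have nextA y : y \in A' -> exists2 f, next s (inl y) = inr f & f \in F'.
  move=> /As yA; have [f ? /andP[fF _]] := next_vertex cs0 yA; by exists f.
have sA y : inl y \in s -> y \in A'.
  by case/(next_vertex cs0) => f _ /andP[/F'A/subsetP]; exact.
have sF f : inr f \in s -> f \in F'.
  by case/(next_edge cs0) => y _ /andP[].
(* The vertex that follows y on the cycle. *)
pose tau y := if next s (next s (inl y)) is inl z then z else y.
have nI := can_inj (prev_next us).
have tauE y : y \in A' -> next s (next s (inl y)) = inl (tau y) /\ tau y \in A'.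
  move=> yA; have [f yf fF] := nextA y yA.
  have fs : inr f \in s by rewrite -yf mem_next As.
  have [z fz _] := next_edge cs0 fs.
  by rewrite /tau yf fz; split=> //; apply: sA; rewrite -fz mem_next.
have tau_inj : {in A' &, injective tau}.
  move=> y z yA zA yz; have [ny _] := tauE y yA; have [nz _] := tauE z zA.
  by have := ny; rewrite yz -nz => /nI /nI [].
have tauA : tau @: A' = A'.
  apply/eqP; rewrite eqEcard card_in_imset // leqnn andbT.
  by apply/subsetP => _ /imsetP[y /tauE[_ ?] ->].
pose L := [set g :\ v | g in link F v] : {set {set V}}.
have delI : {in link F v &, injective (fun g : {set V} => g :\ v)}.
  move=> g h; rewrite !inE => /andP[_ vg] /andP[_ vh] gh.
  by rewrite -(setD1K vg) gh setD1K.
have cL : #|L| = #|link F v| by rewrite card_in_imset.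
have Lr : {in L, forall g : {set V}, #|g| = r.-1}.
  move=> _ /imsetP[g gL ->]; move: gL; rewrite inE => /andP[gF vg].
  by have := cardsD1 v g; rewrite vg Fr // => ->.
set N := cover L.
have NA : N \subset A'.
  apply/bigcupsP => _ /imsetP[g gL ->]; move: gL; rewrite inE => /andP[gF _].
  by rewrite /A' setSD // FA.
pose insertable T := [exists p in N, exists q in N,
  [&& p != q, spread_pair L p q, tau p \in T, tau q \in T &
   [forall y, (next s (inl y) == inr T) ==> (y == p) || (y == q)]]].
have [/exists_inP[T TF /exists_inP[p pN /exists_inP[q qN]]]|none] :=
    boolP [exists T in F', insertable T].
  case/and5P=> pq /spread_pairP[_ [_ [/imsetP[g gL ->] /imsetP[h hL ->]]]].
  move=> gh pg qh pT qT /forallP nT.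
  rewrite -(setD1K vA); move: gL hL pg qh TF.
  rewrite !inE => /andP[gF vg] /andP[hF vh] /andP[_ pg] /andP[_ qh] /andP[TF vT].
  apply: (@hamiltonian_insert _ _ A' (incident F) v g h T p q s us cs) => //.
  - by apply/negP => /sA; rewrite !inE eqxx.
  - by apply/negP => /sF; rewrite !inE vg andbF.
  - by apply/negP => /sF; rewrite !inE vh andbF.
  - rewrite /= !inE negb_or !andbT -andbA; apply/and3P; split.
    + by apply: contraNneq gh => ->.
    + by apply: contraNneq vT => <-.
    + by apply: contraNneq vT => <-.
  - by rewrite /incident gF.
  - by rewrite /incident hF.
  - exact/As/(subsetP NA).
  - exact/As/(subsetP NA).
  - by rewrite /incident gF.
  - by rewrite /incident hF.
  - have [-> _] := tauE p (subsetP NA p pN); move=> z [<-].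
    by rewrite /incident TF.
  - have [-> _] := tauE q (subsetP NA q qN); move=> z [<-].
    by rewrite /incident TF.
  - by move=> y /eqP yT; have := nT y; rewrite yT => /orP[]/eqP->; [left|right].
(* If T followed some y in N, then tau y would lie in T as well, and y forms a
   spread pair with one of p and q; T would be freed by cutting at y. *)
have used T S : T \in F' -> S \subset N -> spread L S -> tau @: S \subset T ->
    exists2 y, y \in A' :\: N & next s (inl y) = inr T.
  move=> TF SN /spreadP[p [q [pS qS pq spq]]] ST.
  have sub x : x \in S -> tau x \in T.
    by move=> xS; apply: (subsetP ST); apply: imset_f.
  have pqN := (subsetP SN p pS, subsetP SN q qS).
  have notins x y : x \in N -> y \in N -> x != y -> spread_pair L x y ->
      tau x \in T -> tau y \in T ->
      exists2 z, next s (inl z) = inr T & (z != x) && (z != y).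
    move=> xN yN xy sxy xT yT; move: none; rewrite negb_exists => /forallP/(_ T).
    rewrite TF /= => /exists_inPn/(_ x xN)/exists_inPn/(_ y yN).
    rewrite xy sxy xT yT /= => /forallPn[z]; rewrite negb_imply negb_or.
    by case/andP=> /eqP zT zxy; exists z.
  have [y yT /andP[yp yq]] := notins p q pqN.1 pqN.2 pq spq (sub p pS) (sub q qS).
  have yA : y \in A'.
    apply: sA; apply: contraT => ys.
    by move: yT; rewrite next_nth (negbTE ys).
  exists y => //; rewrite in_setD yA andbT; apply: contraNN (yp) => yN.
  have nT z : next s (inl z) = inr T -> z = y by rewrite -yT => /nI[].
  have tyT : tau y \in T.
    have [_ _] := tauE y yA; have [ty _] := tauE y yA.
    have Ts : inr T \in s by rewrite -yT mem_next As.
    by have [z] := next_edge cs0 Ts; rewrite -yT ty => -[<-] /andP[].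
  have [spy|syq] := spread_pair_split yN spq.
    have [|z /nT -> /andP[_]] := notins p y pqN.1 yN _ spy (sub p pS) tyT.
      by rewrite eq_sym.
    by rewrite eqxx.
  have [z /nT -> /andP[]] := notins y q yN pqN.2 yq syq tyT (sub q qS).
  by rewrite eqxx.
have [phi phiI phiP] : exists2 phi : {set V} -> {set V}, {in L &, injective phi} &
    {in L, forall g, [/\ phi g \subset cover L, #|phi g| = r.-1 & spread L (phi g)]}.
  by apply: spread_inj => //; rewrite ?cL //; lia.
have cN : r <= #|N|.
  have /card_gt1P[g [h [gL hL gh]]] : 1 < #|L| by rewrite cL.
  have : g \proper g :|: h.
    rewrite properE subsetUl /=; apply: contra gh => ghg; rewrite eq_sym.
    by rewrite eqEcard (Lr g) // (Lr h) // leqnn andbT (subset_trans _ ghg) ?subsetUr.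
  move/proper_card; rewrite Lr // (ltn_predK r2) => /leq_trans; apply.
  by apply: subset_leq_card; rewrite subUset !bigcup_sup.
pose D := [set T : {set V} | T \subset A' & #|T| == r].
have FD : F' \subset D.
  apply/subsetP => T TF; rewrite inE F'A //=.
  by move: TF; rewrite inE => /andP[/Fr -> _].
pose X := [set S in D | spread L (S :&: N)].
have spreadS S S' : S \subset S' -> spread L S -> spread L S'.
  move=> sS /spreadP[p [q [pS qS pq spq]]]; apply/spreadP; exists p, q.
  by split=> //; apply: (subsetP sS).
have large : {in L, forall g : {set V}, #|g| <= r.-1} by move=> g /Lr ->.
have Xup : #|X| <= ('C(#|A'|, r) - #|F'|) + #|A' :\: N|.
  pose edge y := if next s (inl y) is inr T then T else set0.
  have tX : [set tau @: S | S : {set V} in X] \subset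
      (D :\: F') :|: edge @: (A' :\: N).
    apply/subsetP => _ /imsetP[S + ->]; rewrite 2!inE => /andP[/andP[SA cS] sS].
    rewrite inE orbC; case: (boolP (tau @: S \in F')) => TF.
      have [y yN yT] := used _ _ TF (subsetIr S N) sS (imsetS tau (subsetIl S N)).
      by apply/orP; left; apply/imsetP; exists y => //; rewrite /edge yT.
    apply/orP; right; rewrite inE TF inE -{1}tauA imsetS //=.
    by rewrite card_in_imset //; apply: sub_in2 tau_inj; apply/subsetP.
  have tXI : {in X &, injective (fun S : {set V} => tau @: S)}.
    have sub S T : S \subset A' -> T \subset A' -> tau @: S = tau @: T ->
        S \subset T.
      move=> SA TA ST; apply/subsetP => y yS.
      have : tau y \in tau @: T by rewrite -ST imset_f.
      by case/imsetP=> z zT /tau_inj -> //; [apply: (subsetP SA)|apply: (subsetP TA)].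
    move=> S T; rewrite !inE => /andP[/andP[SA _] _] /andP[/andP[TA _] _] ST.
    by apply/eqP; rewrite eqEsubset; apply/andP; split; apply: sub.
  rewrite -(card_in_imset tXI) -cards_draws -/D.
  apply: leq_trans (subset_leq_card tX) _.
  apply: leq_trans (leq_card_setU _ _) _; apply: leq_add (leq_imset_card _ _).
  by rewrite cardsD (setIidPr FD).
have /card_gt0P[S0] : 0 < #|[set S : {set V} | S \subset N & #|S| == r]|.
  by rewrite cards_draws bin_gt0.
rewrite inE => /andP[S0N cS0].
have NX S : S \subset N -> #|S| = r -> S \in X.
  move=> SN cS; rewrite !inE (subset_trans SN NA) cS eqxx /=.
  rewrite (setIidPl SN); apply: (spread_large large SN).
  by rewrite cS prednK //; apply: leq_trans r2.
have Xlow : #|L| * #|A' :\: N| < #|X|.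
  pose psi (gy : {set V} * V) := gy.2 |: phi gy.1.
  have psiN g y : g \in L -> y \in A' :\: N -> psi (g, y) :&: N = phi g.
    move=> gL; rewrite inE => /andP[yN _]; rewrite setIUl /=.
    have [gN _ _] := phiP g gL; rewrite (setIidPl gN); apply/setUidPr.
    by apply/subsetP => z; rewrite !inE => /andP[/eqP->]; rewrite (negbTE yN).
  have psiI : {in setX L (A' :\: N) &, injective psi}.
    move=> [g y] [h z] /setXP[/= gL yN] /setXP[/= hL zN] gh.
    have := psiN g y gL yN; rewrite gh psiN // => /phiI -> //.
    have : y \in psi (h, z) by rewrite -gh !inE eqxx.
    rewrite !inE => /predU1P[->//|yh]; have [/subsetP/(_ y yh) yN' _ _] := phiP h hL.
    by move: yN; rewrite inE yN'.
  rewrite -cardsX -(card_in_imset psiI); apply: proper_card.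
  apply/properP; split.
    apply/subsetP => _ /imsetP[[g y] /setXP[/= gL yN] ->].
    have [gN cg sg] := phiP g gL; rewrite inE psiN // sg andbT inE.
    move: yN; rewrite inE => /andP[yN yA].
    rewrite /psi subUset sub1set yA (subset_trans gN NA) /= cardsU1 cg.
    by rewrite (contra (subsetP gN y) yN) add1n prednK //; apply: leq_trans r2.
  exists S0; first by apply: NX => //; apply/eqP.
  apply/imsetP => -[[g y] /setXP[/= gL]]; rewrite inE => /andP[yN _] S0E.
  by move/subsetP: S0N => /(_ y); rewrite S0E !inE eqxx (negbTE yN) => /(_ isT).
(* When N is everything, any edge of the cycle contradicts [used]. *)
have [b0|b0] := posnP #|A' :\: N|.
  move/eqP: b0; rewrite cards_eq0 setD_eq0 => AN.
  have /card_gt0P[y yN] : 0 < #|N| by apply: leq_trans cN; apply: leq_trans r2.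
  have [f yf fF] := nextA y (subsetP NA y yN).
  pose S := [set z in A' | tau z \in f].
  have tS : tau @: S = f.
    apply/setP => z; apply/imsetP/idP => [[x]|zf]; first by rewrite inE => /andP[_ ? ->].
    have : z \in tau @: A' by rewrite tauA (subsetP (F'A f fF)).
    by case/imsetP=> x xA zx; exists x; rewrite // inE xA -zx.
  have SA : S \subset A' by apply/subsetP => z; rewrite inE => /andP[].
  have cS : #|S| = r.
    rewrite -(@card_in_imset _ _ tau) ?tS; last by apply: sub_in2 tau_inj; apply/subsetP.
    by move: fF; rewrite inE => /andP[/Fr].
  have SN := subset_trans SA AN.
  have sS : spread L S.
    by have := NX S SN cS; rewrite inE (setIidPl SN) => /andP[].
  have [|z] := used f S fF SN sS; first by rewrite tS.
  by rewrite inE => /andP[zN /(subsetP AN)]; rewrite (negbTE zN).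
have FC : #|F'| <= 'C(#|A'|, r) by rewrite -cards_draws subset_leq_card.
rewrite cL in Xlow; have := insert_arith dense d2 b0 FC (leq_trans Xlow Xup).
by [].
Qed.
End Insert.

(** * A vertex hanging on a single edge *)

Section Detour.
Variable V : finType.
Implicit Types (A S T e : {set V}) (F : {set {set V}}).

(** The only sets at w are e and the auxiliary f, so the cycle uses f next to w,
    in a step from some a through f to w. This step is replaced by a, g, v, g',
    w, where g is the one of f0 and f1 containing a and g' is the other
    one. *)
Lemma hamiltonian_detour A F v w e f f0 f1 :
    {in F, forall e, e \subset A} -> v \in A -> 1 < #|A :\ v| -> link (avoiding F v) w = [set e] ->
    f \notin avoiding F v -> f \subset A :\ v -> w \in f -> 
    f0 \in F -> f1 \in F -> f0 != f1 -> v \in f0 -> v \in f1 ->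
    w \in f0 -> w \in f1 -> f \subset f0 :|: f1 ->
  hamiltonian (A :\ v) (incident (f |: avoiding F v)) -> hamiltonian A (incident F).
Proof.
set F' := avoiding F v; set F1 := f |: F'.
move=> FA vA A2 Lw fF' fA wf f0F f1F f01 vf0 vf1 wf0 wf1 f01s [s0 [us0 cs0 As0]].
have F1v e' : e' \in F1 -> v \notin e'.
  rewrite !inE => /orP[/eqP->|/andP[]//].
  by apply/negP => /(subsetP fA); rewrite !inE eqxx.
have link2 e' : incident F1 w e' -> e' = f \/ e' = e.
  rewrite /incident => /andP[/setU1P[->|e'F] we']; first by left.
  right; apply/set1P; rewrite -Lw inE e'F /=.
  exact: we'.
have ws0 : inl w \in s0 by apply: As0; apply: (subsetP fA).
have [s [us cs As [e1 [C sE]]]] : exists s, [/\ uniq s, cycle (incidence (incident F1)) s,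
    {in A :\ v, forall x, inl x \in s} &
    exists e1 C, s = [:: inl w, inr e1 & rcons C (inr f)]].
  have [e1 [C [us cs ss _]]] := rotate_to_vertex us0 cs0 ws0.
  case/lastP: C us cs ss => [|C b] us cs ss.
    have : A :\ v \subset [set w].
      by apply/subsetP => x /As0; rewrite ss !inE orbF => /eqP[->].
    by move/subset_leq_card; rewrite cards1 leqNgt A2.
  have [ur cr sr] := reverse_at (incident F1) (inl w) (inr e1) b C.
  have := cs; rewrite /= rcons_path => /and3P[we1 _].
  rewrite last_rcons; case: b us cs ss ur cr sr => [//|b] us cs ss ur cr sr wb.
  have e1b : e1 != b.
    move: us; rewrite /= mem_rcons inE negb_or => /and3P[_ /andP[e1b _] _].
    by apply: contraNneq e1b => ->.
  have [bf|be] := link2 b wb.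
    exists [:: inl w, inr e1 & rcons C (inr b)]; split=> //.
      by move=> x /As0; rewrite ss.
    by exists e1, C; rewrite bf.
  have [ef|ee] := link2 e1 we1; last by rewrite be ee eqxx in e1b.
  exists [:: inl w, inr b & rcons (rev C) (inr e1)]; split=> //.
  - by rewrite -ur.
  - by rewrite -cr.
  - by move=> x /As0; rewrite ss sr.
  - by exists b, (rev C); rewrite ef.
have gs (x : {set V}) : v \in x -> inr x \notin s.
  move=> vx; apply/negP => /(next_edge cs) [y _ /andP[/F1v]].
  by rewrite vx.
have vs : inl v \notin s.
  by apply/negP => /(next_vertex cs) [x _ /andP[/F1v/negP]].
have fC : inr f \notin (inr e1 : V + {set V}) :: C.
  move: us; rewrite sE -rcons_cons -rcons_cons rcons_uniq inE negb_or.
  by case/andP=> /andP[].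
move: cs; rewrite sE /= rcons_path last_rcons rcons_path.
case/and3P=> we1 /andP[pC lastf] _.
case La : (last (inr e1) C) lastf => [a|//] af.
have {}af : a \in f by case/andP: af.
have aw : a != w.
  have : inl a \in C.
    have := mem_last (inr e1 : V + {set V}) C.
    by rewrite La inE.
  move: us; rewrite sE /= => /andP[]; rewrite inE mem_rcons inE /= => + _.
  by move=> wC aC; apply: contraNneq wC => <-.
have [g [g' [gF g'F gg' [vg vg' ag wg']]]] : exists g g', [/\ g \in F, g' \in F, g != g' &
    [/\ v \in g, v \in g', a \in g & w \in g']].
  have /setUP[a0|a1] := subsetP f01s a af.
    by exists f0, f1.
  by exists f1, f0; rewrite eq_sym.
have F1F e' : e' \in F1 -> e' != f -> e' \in F.
  by rewrite !inE => /orP[->//|/andP[]].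
have [X XE] : exists X : seq (V + {set V}), X = [:: inl w, inr e1 & C] by eexists.
have sX : s = rcons X (inr f) by rewrite XE.
have Xs x : x \notin s -> x \notin X.
  by rewrite sX mem_rcons inE negb_or => /andP[].
have uX : uniq X by move: us; rewrite sX rcons_uniq => /andP[].
exists [:: inl v, inr g' & rcons X (inr g)]; split.
- rewrite !cons_uniq rcons_uniq uX andbT !(in_cons, mem_rcons) !negb_or.
  by rewrite !Xs ?gs // !andbT /=; apply: contraNneq gg' => -[->].
- have pX : path (incidence (incident F)) (inr e1) C.
    apply: (@sub_in_path _ (predC1 (inr f))) pC; last first.
      by apply/allP => x xC; apply: contraNneq fC => <-.
    move=> [x|x] [y|y] //= xf yf /andP[zF ?]; apply/andP; split=> //.
      by apply: F1F zF _; apply: contraNneq yf => ->; rewrite eqxx.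
    by apply: F1F zF _; apply: contraNneq xf => ->; rewrite eqxx.
  have e1f : e1 != f by apply: contraNneq fC => ->; rewrite inE eqxx.
  rewrite XE /= rcons_path last_rcons rcons_path pX La /=.
  case/andP: we1 => /F1F/(_ e1f) e1F we1.
  by rewrite /incident e1F we1 g'F gF vg vg' ag wg'.
- move=> x xA; rewrite !(in_cons, mem_rcons) /=.
  have [->|xv] := eqVneq x v; first by rewrite eqxx.
  have : inl x \in s by apply: As; rewrite !inE xv.
  by rewrite sX mem_rcons inE /= => ->; rewrite !orbT.
Qed.
End Detour.

(** * Degrees in uniform families *)

(** Deleting a vertex of minimum degree d <= r f / n leaves at least
    f (n - r) / n edges. This exceeds c' = c (n - 1 - r) / (n - 1), because
    (n - r) / n > (n - 1 - r) / (n - 1). *)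
Lemma min_degree_arith n r f d c c' :
  r < n.-1 -> c < f -> n * d <= r * f -> n.-1 * c' = (n.-1 - r) * c ->
  c' < f - d.
Proof.
move=> rn cf nd cc; rewrite ltnNge; apply/negP => le.
have [m nE] : exists m, n = (m + r).+2 by exists (n - r - 2); lia.
rewrite {}nE /= in rn nd cc; rewrite (_ : _ - r = m.+1) in cc; last by lia.
have : f <= c' + d by lia.
clear le rn => le.
have h1 : (m + r).+2 * f <= (m + r).+2 * c' + r * f by nia.
have h2 : m.+2 * c.+1 <= (m + r).+2 * c' by nia.
have h3 : (m + r).+1 * (m.+2 * c.+1) <= (m + r).+2 * (m.+1 * c) by rewrite -cc; nia.
clear -h3; nia.
Qed.

Section Degrees.
Variable V : finType.
Implicit Types (A S T e : {set V}) (F : {set {set V}}).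

Lemma two_degree_arith n m : 4 < n -> n < m -> m - 2 + (m - 2) <= m + 1 -> False.
Proof. lia. Qed.

(** Edges are deleted until there are as many as vertices. As long as there are
    more, at most one vertex has degree at most two: two such vertices are
    missed together by one edge at most, so they would be missed by more edges
    than there are. Deleting an edge that avoids this vertex keeps all degrees
    at least two. *)
Lemma base_hamiltonian A F :
    4 < #|A| -> {in F, forall e, e \subset A} ->
    {in F, forall e, #|A :\: e| = 2} -> #|A| <= #|F| ->
    {in A, forall x, 1 < #|link F x|} ->
  hamiltonian A (incident F).
Proof.
move=> A5; move Ek : (#|F| - #|A|) => k.
elim: k F Ek => [|k IH] F Ek FA F2 AF d2.
  have AF' : #|A| = #|F| by apply/eqP; rewrite eqn_leq AF -subn_eq0 Ek.
  exact: near_complete_hamiltonian.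
have AF1 : #|A| < #|F| by rewrite -subn_gt0 Ek.
have one u w : u \in A -> w \in A -> u != w -> #|link F u| <= 2 -> #|link F w| <= 2 -> False.
  move=> uA wA uw du dw.
  apply: (two_degree_arith A5 AF1).
  have cI : #|avoiding F u :&: avoiding F w| <= 1.
    rewrite -(cards1 (A :\: [set u; w])); apply/subset_leq_card/subsetP => e.
    rewrite !inE => /andP[/andP[eF ue] /andP[_ we]]; apply/eqP.
    have : [set u; w] == A :\: e.
      rewrite eqEcard cards2 uw (F2 e eF) leqnn andbT.
      by apply/subsetP => x; rewrite !inE => /orP[]/eqP->; rewrite ?ue ?we ?uA ?wA.
    move/eqP=> ->; rewrite setDDr setDv set0U; apply/esym/setIidPr.
    exact: FA.
  apply: leq_trans (leq_add (_ : _ <= #|avoiding F u|) (_ : _ <= #|avoiding F w|)) _.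
  - by rewrite leq_subLR -(card_avoiding F u) [2 + _]addnC leq_add2l.
  - by rewrite leq_subLR -(card_avoiding F w) [2 + _]addnC leq_add2l.
  - rewrite -cardsUI; apply: leq_add cI; apply/subset_leq_card/subsetP => e.
    by rewrite !inE => /orP[]/andP[].
(* An edge avoiding the possible vertex of degree two can be spared. *)
have [e eF de] : exists2 e, e \in F & {in e, forall x, 2 < #|link F x|}.
  have [/exists_inP[w wA dw]|none] := boolP [exists w in A, #|link F w| <= 2].
    have /card_gt0P[e] : 0 < #|avoiding F w|.
      have := card_avoiding F w; case: posnP => // ->; rewrite add0n => cF.
      move: AF1 A5; rewrite -cF ltnNge => /negP + A5; case.
      by apply: leq_trans dw _; apply: leq_trans A5.
    rewrite inE => /andP[eF we]; exists e => // x xe.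
    rewrite ltnNge; apply/negP => dx; apply: (one x w) => //.
      exact: (subsetP (FA e eF)).
    by apply: contraNneq we => <-.
  have /card_gt0P[e eF] : 0 < #|F| by apply: leq_ltn_trans AF1.
  exists e => // x xe; rewrite ltnNge; apply: contra none => dx.
  by apply/exists_inP; exists x => //; apply: (subsetP (FA e eF)).
have cF := cardsD1 e F; rewrite eF in cF.
have sub : F :\ e \subset F by apply: subsetDl.
have : hamiltonian A (incident (F :\ e)).
  apply: IH => [|f /(subsetP sub)/FA|f /(subsetP sub)/F2||x xA] //.
  - by apply/eqP; rewrite -eqSS -Ek cF subSn //; rewrite cF ltnS in AF1.
  - by rewrite cF ltnS in AF1.
  have [xe|xe] := boolP (x \in e).
    have : #|link F x| <= #|e |: link (F :\ e) x|.
      apply/subset_leq_card/subsetP => f; rewrite !inE.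
      by case: eqVneq => //= _ ->.
    move/(leq_trans (de x xe)); rewrite cardsU1 => /leq_trans-/(_ _ (leq_add (leq_b1 _) (leqnn _))).
    by [].
  apply: leq_trans (d2 x xA) _; apply/subset_leq_card/subsetP => f; rewrite !inE.
  by case: eqVneq => [->|] //=; rewrite (negbTE xe) andbF.
apply: sub_hamiltonian => x f; rewrite /incident !inE -andbA => /and3P[_ -> ->] //.
Qed.


Lemma card_uniform A F r : {in F, forall e, e \subset A} ->
  {in F, forall e, #|e| = r} -> #|F| <= 'C(#|A|, r).
Proof.
move=> FA Fr; rewrite -cards_draws; apply/subset_leq_card/subsetP => e eF.
by rewrite inE FA //= Fr.
Qed.

Lemma avoidingS F x : avoiding F x \subset F.
Proof. by apply/subsetP => e; rewrite inE => /andP[]. Qed.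

Lemma avoiding_sub A F x : {in F, forall e, e \subset A} ->
  {in avoiding F x, forall e, e \subset A :\ x}.
Proof.
move=> FA e; rewrite inE => /andP[eF xe]; apply/subsetP => y ye; rewrite !inE.
by rewrite (subsetP (FA e eF)) // andbT; apply: contraNneq xe => <-.
Qed.

Lemma card_avoiding_uniform A F r x : x \in A -> {in F, forall e, e \subset A} ->
  {in F, forall e, #|e| = r} -> #|avoiding F x| <= 'C(#|A|.-1, r).
Proof.
move=> xA FA Fr; have -> : #|A|.-1 = #|A :\ x| by rewrite (cardsD1 x A) xA.
by apply: card_uniform (avoiding_sub FA) _ => e /(subsetP (avoidingS F x))/Fr.
Qed.

Lemma sum_links A F r : {in F, forall e, e \subset A} ->
  {in F, forall e, #|e| = r} -> \sum_(x in A) #|link F x| = r * #|F|.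
Proof.
move=> FA Fr; transitivity (\sum_(x in A) \sum_(e in F) (x \in e : nat)).
  apply: eq_bigr => x _; rewrite -sum1_card big_mkcond /=.
  rewrite [RHS]big_mkcond; apply: eq_bigr => e _; rewrite inE.
  by case: (e \in F); case: (x \in e).
rewrite exchange_big /= mulnC -sum_nat_const; apply: eq_bigr => e eF.
rewrite -(Fr e eF) -sum1_card [RHS]big_mkcond /= big_mkcond /=.
apply: eq_bigr => x _; have := subsetP (FA e eF) x.
by case: (x \in e) => [-> //|_]; case: (x \in A).
Qed.

Lemma low_degree_vertex A F r : r < #|A|.-1 -> {in F, forall e, e \subset A} ->
  {in F, forall e, #|e| = r} -> 'C(#|A|.-1, r) < #|F| ->
  exists2 v, v \in A & {in A, forall x, #|link F v| <= #|link F x|} /\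
    'C(#|A|.-2, r) < #|avoiding F v|.
Proof.
move=> rA FA Fr cF; have /card_gt0P[x0 x0A] : 0 < #|A| by lia.
case: (@arg_minnP _ x0 (mem A) (fun x => #|link F x|)) => // v vA vmin.
exists v => //; split=> // .
rewrite (_ : #|avoiding F v| = #|F| - #|link F v|); last first.
  by rewrite -(card_avoiding F v) addnK.
apply: (min_degree_arith rA cF); last by rewrite mul_bin_down.
rewrite -(sum_links FA Fr) -sum_nat_const; apply: leq_sum => x xA.
exact: vmin.
Qed.

End Degrees.

(** * Many edges and degrees at least two *)

Lemma leq_bin_codim2 m r : 2 < r -> r < m -> r < 'C(m, r.-1).
Proof.
case: r => [|r] //= r2 rm; apply: leq_trans (leq_bin2l _ rm).
have <- : 'C(r.+2, 2) = 'C(r.+2, r) by rewrite -(@bin_sub r.+2 2) // subn2.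
have : 0 < 'C(r.+1, 2) by rewrite bin_gt0; apply: ltn_trans r2.
by rewrite [X in _ -> _ < X]binS bin1; lia.
Qed.

Lemma pendant_arith1 f g l c :
  g + l = f -> c < f -> l <= 1 -> g <= c -> l = 1 /\ g = c.
Proof. lia. Qed.

Lemma pendant_arith2 f f' d g l c c1 :
  f' + d = f -> g + l = f' -> c + c1 < f -> g = c -> l = 1 -> c1 <= d.
Proof. lia. Qed.

Section Induction.
Variable V : finType.
Implicit Types (A S T e : {set V}) (F : {set {set V}}).

Lemma link_lower A F r x : x \in A -> {in F, forall e, e \subset A} ->
  {in F, forall e, #|e| = r} -> #|F| <= 'C(#|A|.-1, r) + #|link F x|.
Proof.
move=> xA FA Fr; rewrite -(card_avoiding F x) leq_add2r.
exact: card_avoiding_uniform.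
Qed.

(** Deleting v leaves the complete family on A - v - w and a single edge e at w.
    As v has minimum degree, at least r edges contain both v and w. Two of
    these, f0 and f1, cover an r-set f avoiding v that is not an edge. With f
    added, all degrees are at least two, and the Hamiltonian cycle that exists
    by hypothesis is detoured through v. *)
Lemma pendant_hamiltonian A F r v w :
    2 < r -> r + 2 < #|A| -> {in F, forall e, e \subset A} ->
    {in F, forall e, #|e| = r} -> 'C(#|A|.-1, r) < #|F| ->
    v \in A -> w \in A :\ v -> #|link F v| <= #|link F w| ->
    'C(#|A|.-2, r) < #|avoiding F v| -> #|link (avoiding F v) w| <= 1 ->
    (forall F1, {in F1, forall e, e \subset A :\ v} -> {in F1, forall e, #|e| = r} ->
      'C(#|A|.-2, r) < #|F1| -> {in A :\ v, forall x, 1 < #|link F1 x|} ->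
      hamiltonian (A :\ v) (incident F1)) ->
  hamiltonian A (incident F).
Proof.
move=> r2 rA FA Fr cF vA wA' dvw cF' lw IH.
set F' := avoiding F v in cF' lw *; set A' := A :\ v in wA' IH *.
have F'A := avoiding_sub (x := v) FA; rewrite -/F' -/A' in F'A.
have F'r : {in F', forall e : {set V}, #|e| = r}.
  by move=> e /(subsetP (avoidingS F v))/Fr.
have [m mE] : exists m, #|A| = m.+2 by exists #|A|.-2; lia.
have cA' : #|A'| = m.+1 by move: (cardsD1 v A); rewrite vA mE => -[].
have cA'' : #|A' :\ w| = m by move: (cardsD1 w A'); rewrite wA' cA' => -[].
rewrite mE /= in cF cF' IH.
have rm : r < m by move: rA; rewrite mE; lia.
have cG := card_avoiding_uniform wA' F'A F'r; rewrite cA' /= in cG.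
have [lw1 cG'] : #|link F' w| = 1 /\ #|avoiding F' w| = 'C(m, r).
  exact: pendant_arith1 (card_avoiding F' w) cF' lw cG.
have /eqP/cards1P[e lwE] := lw1.
have eF : e \in link F' w by rewrite lwE inE.
have [/setIdP[eF' we] er] : e \in link F' w /\ #|e| = r.
  by split=> //; apply: F'r; move: eF; rewrite inE => /andP[].
have d1 : 'C(m, r.-1) <= #|link F v|.
  apply: (pendant_arith2 (card_avoiding F v) (card_avoiding F' w) _ cG' lw1).
  by move: cF; case: (r) r2 => // r' _; rewrite binS.
pose W := link (link F w) v.
have cW : #|link F w| = #|W|.+1.
  rewrite -(card_avoiding (link F w) v) -/W -add1n -lw1; congr (_ + _).
  by apply: eq_card => f; rewrite !inE andbAC.
have rW : r <= #|W|.
  by rewrite -ltnS -cW; apply: leq_trans dvw; apply: leq_trans d1; apply: leq_bin_codim2.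
have WP f : f \in W -> [/\ f \in F, v \in f & w \in f].
  by rewrite !inE -andbA => /and3P[].
have ve : v \notin e by move: eF'; rewrite inE => /andP[].
have vw : w != v by move: wA'; rewrite !inE => /andP[].
(* Only r - 1 of the edges through v and w lie in v |: e. *)
have [f0 f0W f0e] : exists2 f0, f0 \in W & ~~ (f0 :\ v \subset e).
  have : ~~ (W \subset [set v |: (e :\ z) | z in e :\ w]).
    apply/negP => /subset_leq_card/leq_trans/(_ (leq_imset_card _ _)).
    rewrite leqNgt; case/negP; apply: leq_trans rW.
    by have := cardsD1 w e; rewrite we er => ->.
  case/subsetPn=> f fW fim; exists f => //; apply: contra fim => fe.
  have [fF vf wf] := WP f fW.
  have /eqP/cards1P[z ezE] : #|e :\: (f :\ v)| = 1.
    rewrite cardsD (setIidPr fe) er; have := cardsD1 v f.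
    by rewrite vf (Fr f fF) => ->; rewrite addnK.
  have zef : z \in e :\: (f :\ v) by rewrite ezE inE.
  apply/imsetP; exists z.
    move: zef; rewrite !inE => /andP[zf ->]; rewrite andbT.
    by apply: contraNneq zf => ->; rewrite vw wf.
  have -> : e :\ z = f :\ v; last by rewrite setD1K.
  by rewrite -ezE setDDr setDv set0U; apply/setIidPr.
have [f0F vf0 wf0] := WP f0 f0W.
have /card_gt0P[f1] : 0 < #|W :\ f0|.
  have cW1 := cardsD1 f0 W; rewrite f0W add1n in cW1.
  by rewrite -ltnS -cW1; apply: leq_trans rW; apply: ltnW.
rewrite in_setD1 => /andP[f10 f1W]; have [f1F vf1 wf1] := WP f1 f1W.
have /subsetPn[y yf1 yf0] : ~~ (f1 \subset f0).
  by apply: contra f10 => f10; rewrite eqEcard f10 !Fr // leqnn.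
(* Containing f0 :\ v, the set f is different from e. *)
pose f := y |: (f0 :\ v).
have yv : y != v by apply: contraNneq yf0 => ->.
have wf : w \in f by rewrite !inE vw wf0 orbT.
have fr : #|f| = r.
  rewrite cardsU1 !inE (negbTE yf0) andbF; have := cardsD1 v f0.
  by rewrite vf0 (Fr f0 f0F) => ->.
have fA : f \subset A'.
  by rewrite subUset sub1set !inE yv (subsetP (FA f1 f1F)) //= setSD // FA.
have fF' : f \notin F'.
  apply: contra f0e => fF'; have : f \in link F' w by rewrite inE fF'.
  by rewrite lwE inE => /eqP <-; apply: subsetUr.
apply: (@hamiltonian_detour _ A F v w e f f0 f1) => //.
- by rewrite cA'; move: rm; clear; lia.
- by rewrite eq_sym.
- rewrite subUset sub1set inE yf1 orbT /=.
  by apply: subset_trans (subsetUl _ _); apply: subsetDl.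
have G1 : avoiding F' w \subset f |: F'.
  by apply: subset_trans (avoidingS F' w) (subsetUr _ _).
apply: IH => [g|g||x xA].
- by rewrite inE => /orP[/set1P->|/F'A].
- by rewrite inE => /orP[/set1P->|/F'r].
- by rewrite cardsU1 fF' -/F'; apply: leq_trans cF' (leq_addl _ _).
have [->|xw] := eqVneq x w.
  apply: (@leq_trans #|[set e; f]|).
    rewrite cards2; suff -> : e != f by [].
    by apply: contraNneq fF' => <-.
  apply/subset_leq_card/subsetP => g /set2P[]->; rewrite inE in_setU1.
    by rewrite eF' orbT we.
  by rewrite eqxx wf.
apply: (@leq_trans #|link (avoiding F' w) x|); last first.
  apply/subset_leq_card/subsetP => g; rewrite inE => /andP[/(subsetP G1) gF xg].
  by rewrite inE gF.
have xA'' : x \in A' :\ w by rewrite inE xA andbT inE.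
have := link_lower xA'' (avoiding_sub F'A) (fun g gG => F'r g (subsetP (avoidingS F' w) g gG)).
rewrite cG' cA''; move: rm r2; clear; case: m => // m; case: r => // r.
rewrite binS ltnS /= => rm r2; rewrite leq_add2l; apply: leq_trans.
apply: (@leq_trans 'C(r.+1, r)); first by rewrite binSn ltnW.
exact: leq_bin2l.
Qed.

(** Deleting a vertex of minimum degree preserves the bound on the number of
    edges, but it may destroy the bound on the degrees; [pendant_hamiltonian]
    treats that case. *)
Theorem uniform_hamiltonian A F r :
    2 < r -> r + 2 <= #|A| -> {in F, forall e, e \subset A} ->
    {in F, forall e, #|e| = r} -> 'C(#|A|.-1, r) < #|F| ->
    {in A, forall x, 1 < #|link F x|} ->
  hamiltonian A (incident F).
Proof.
move=> r2; move Ek : (#|A| - (r + 2)) => k.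
elim: k A F Ek => [|k IH] A F Ek rA FA Fr cF d2.
  have cA : #|A| = r.+2 by move: Ek rA; clear; lia.
  apply: base_hamiltonian => //.
  - by rewrite cA.
  - by move=> e eF; rewrite cardsD (setIidPr (FA e eF)) cA Fr // -addn2 addKn.
  - by move: cF; rewrite cA /= binSn.
have rA' : r + 2 < #|A| by move: Ek; clear; lia.
have rA1 : r < #|A|.-1 by move: rA'; clear; lia.
have [v vA [vmin cF']] := low_degree_vertex rA1 FA Fr cF.
have cA' : #|A :\ v| = #|A|.-1 by rewrite (cardsD1 v A) vA.
have IHv F1 : {in F1, forall e, e \subset A :\ v} -> {in F1, forall e, #|e| = r} ->
    'C(#|A|.-2, r) < #|F1| -> {in A :\ v, forall x, 1 < #|link F1 x|} ->
    hamiltonian (A :\ v) (incident F1).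
  move=> F1A F1r cF1 d1; apply: IH => //; rewrite cA' //.
    by move: Ek; clear; lia.
  by move: rA'; clear; lia.
have [/exists_inP[w wA lw]|none] :=
    boolP [exists w in A :\ v, #|link (avoiding F v) w| <= 1].
  apply: (pendant_hamiltonian r2 rA' FA Fr cF vA wA) => //.
  by apply: vmin; move: wA; rewrite inE => /andP[].
apply: (insert_vertex r2 FA Fr vA (d2 v vA)).
  by rewrite cA' card_avoiding.
apply: IHv => //; first exact: avoiding_sub.
- by move=> e /(subsetP (avoidingS F v))/Fr.
- move=> x xA; rewrite ltnNge; apply: contra none => lx.
  by apply/exists_inP; exists x.
Qed.

End Induction.

(** * Berge cycles and Berge paths as incidence cycles *)

Section Alternate.
Variables V E : finType.
Variable I : V -> E -> bool.

Definition unfold_pairs (ps : seq (E * V)) : seq (V + E) :=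
  flatten [seq [:: inr p.1; inl p.2] | p <- ps].

Lemma incidence_cycle_pairs e (C : seq (V + E)) :
  cycle (incidence I) (inr e :: C) ->
  exists x ps, inr e :: C = unfold_pairs ((e, x) :: ps).
Proof.
rewrite /= rcons_path => /andP[].
move: {3}e => g.
have [n] := ubnP (size C); elim: n e C => // n IH e [|[x|//] [|[//|f] C]] //=.
- by move=> _ _ _; exists x, [::].
- by rewrite andbF.
rewrite ltnS => sC /and3P[_ _ pC] lC.
have [y [ps ->]] := IH f C (leq_trans (leqnSn _) sC) pC lC.
by exists x, ((f, y) :: ps).
Qed.

Lemma cycle_unfold_pairs p ps : cycle (incidence I) (unfold_pairs (p :: ps)) ->
  all (fun p => I p.2 p.1) (p :: ps) &&
  cycle (fun p q => I p.2 q.1) (p :: ps).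
Proof.
rewrite [cycle _ _]/= -/(unfold_pairs ps) [all _ _]/= [X in _ && X]/=.
case: p => e x /=; rewrite -andbA => /andP[->] /=.
suff gen f y : path (incidence I) (inl y) (rcons (unfold_pairs ps) (inr e)) ->
  all (fun p => I p.2 p.1) ps && path (fun p q => I p.2 q.1) (f, y) (rcons ps (e, x)).
  exact: (gen e x).
elim: ps f y => [|[g z] ps IH] f y //=.
by move=> /and3P[-> -> /(IH g)/andP[-> ->]].
Qed.
End Alternate.

Section Berge.
Variables (V : finType) (r : nat) (H : uhypergraph r V).
Local Notation F := (edges H).

Lemma uniq_unfold_pairs (W E : eqType) (ps : seq (E * W)) :
  uniq (flatten [seq [:: inr p.1; inl p.2] | p <- ps] : seq (W + E)) ->
  uniq [seq p.1 | p <- ps] /\ uniq [seq p.2 | p <- ps].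
Proof.
have pe : perm_eq (flatten [seq [:: inr p.1; inl p.2] | p <- ps] : seq (W + E))
    ([seq inr p.1 | p <- ps] ++ [seq inl p.2 | p <- ps]).
  apply/permP => P; rewrite count_cat; elim: ps => //= p ps ->.
  by rewrite addnACA addnA.
rewrite (perm_uniq pe) cat_uniq => /and3P[u1 _ u2]; split.
  by rewrite -(@map_inj_uniq _ (W + E)%type inr) -?map_comp // => ? ? [].
by rewrite -(@map_inj_uniq _ (W + E)%type inl) -?map_comp // => ? ? [].
Qed.

(** The cycle is rotated so that it starts with f if it uses f at all; then f can
    only be its first edge, and dropping the first edge leaves a path that does
    not use f. *)
Lemma hamiltonian_pairs (G : {set {set V}}) f : 0 < #|V| ->
  hamiltonian [set: V] (incident G) -> exists p ps,
  [/\ uniq [seq q.1 | q <- p :: ps], uniq [seq q.2 | q <- p :: ps],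
      all (fun q => incident G q.2 q.1) (p :: ps),
      cycle (fun q q' => incident G q.2 q'.1) (p :: ps) &
      (forall x, x \in [seq q.2 | q <- p :: ps]) /\ f \notin [seq q.1 | q <- ps]].
Proof.
case/card_gt0P=> x0 _ [s [us cs sV]].
have {}sV x : inl x \in s by apply: sV; rewrite inE.
have [e [es fs]] : exists e, inr e \in s /\ (inr f \in s -> e = f).
  have [fs|fs] := boolP (inr f \in s); first by exists f.
  have [e xe _] := next_vertex cs (sV x0); exists e; split=> //.
  by rewrite -xe mem_next.
have [i t Ht] := rot_to es.
have cs' := cs; rewrite -(rot_cycle i) Ht in cs'.
have [x [ps sE]] := incidence_cycle_pairs cs'.
have us' := us; rewrite -(rot_uniq i) Ht sE in us'.
rewrite sE in cs'; have [u1 u2] := uniq_unfold_pairs us'.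
have /andP[a1 c1] := cycle_unfold_pairs cs'.
have mE y : (y \in s) = (y \in unfold_pairs ((e, x) :: ps)) by rewrite -sE -Ht mem_rot.
exists (e, x), ps; split=> //; split.
  move=> y; have := sV y; rewrite mE => /flattenP[_ /mapP[q qps ->]].
  move=> yq; apply/mapP; exists q => //; move: yq; rewrite !inE => /eqP[]; exact.
apply/negP => fps; have ef : e = f.
  apply: fs; rewrite mE; case/mapP: fps => q qps ->; apply/flattenP.
  exists [:: inr q.1; inl q.2]; last by rewrite inE eqxx.
  by apply: map_f; rewrite inE qps orbT.
by move: u1; rewrite /= ef fps.
Qed.

Lemma hamiltonian_Berge_cycle : 0 < #|V| ->
  hamiltonian [set: V] (incident F) -> has_Hamiltonian_Berge_cycle H.
Proof.
move=> V0 /(hamiltonian_pairs set0 V0)[p [ps [u1 u2 a1 c1 [sV _]]]].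
set s := p :: ps in u1 u2 a1 sV.
have lt (i : 'I_(size s)) : i < size s by [].
exists (size s), (fun i => (nth p s i).2), (fun i => (nth p s i).1); split.
  split.
  - move=> i j ij; apply/val_inj/eqP.
    rewrite -(nth_uniq p.2 _ _ u2) ?size_map ?lt //.
    by rewrite !(nth_map p) ?lt //; apply/eqP.
  - move=> i j ij; apply/val_inj/eqP.
    rewrite -(nth_uniq p.1 _ _ u1) ?size_map ?lt //.
    by rewrite !(nth_map p) ?lt //; apply/eqP.
  - by move=> i; have /allP/(_ _ (mem_nth p (lt i)))/andP[] := a1.
  - move=> i; rewrite inE; apply/andP; split.
      by have /allP/(_ _ (mem_nth p (lt i)))/andP[] := a1.
    have /(pathP p)/(_ i) := c1; rewrite size_rcons => /(_ (lt i))/andP[_].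
    rewrite -rcons_cons nth_rcons lt /= nth_rcons.
    have := lt i; rewrite ltnS leq_eqVlt => /orP[/eqP iC|iC].
      by rewrite iC ltnn eqxx modnn.
    by rewrite iC modn_small.
move=> x; have /mapP[q qs ->] := sV x.
have qi : index q s < size s by rewrite index_mem.
by exists (Ordinal qi); rewrite /= nth_index.
Qed.

Lemma hamiltonian_Berge_path f : 0 < #|V| ->
  hamiltonian [set: V] (incident (f |: F)) -> has_Hamiltonian_Berge_path H.
Proof.
move=> V0 /(hamiltonian_pairs f V0)[p [ps [u1 u2 a1 c1 [sV fps]]]].
set s := p :: ps in u1 u2 a1 sV.
have lt (i : 'I_(size s)) : i < size s by [].
have lt1 (i : 'I_(size s).-1) : i < size ps by [].
exists (size s), (fun i => (nth p s i).2), (fun i => (nth p ps i).1); split.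
  split.
  - move=> i j ij; apply/val_inj/eqP.
    rewrite -(nth_uniq p.2 _ _ u2) ?size_map ?lt //.
    by rewrite !(nth_map p) ?lt //; apply/eqP.
  - move=> i j ij; apply/val_inj/eqP; case/andP: u1 => _ u1.
    rewrite -(nth_uniq p.1 _ _ u1) ?size_map ?lt1 //.
    by rewrite !(nth_map p) ?lt1 //; apply/eqP.
  - move=> i; case/andP: a1 => _ /allP/(_ _ (mem_nth p (lt1 i)))/andP[].
    case/setU1P=> [fi|//]; case/negP: fps; rewrite -fi.
    by apply: map_f; apply: mem_nth.
  - move=> i j k ji ki; rewrite ji ki subUset !sub1set /=; apply/andP; split.
      have /(pathP p)/(_ i) := c1; rewrite size_rcons => /(_ (leqW (lt1 i)))/andP[_].
      by rewrite -rcons_cons !nth_rcons lt1 /= ltnS ltnW ?lt1.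
    by case/andP: a1 => _ /allP/(_ _ (mem_nth p (lt1 i)))/andP[].
move=> x; have /mapP[q qs ->] := sV x.
have qi : index q s < size s by rewrite index_mem.
by exists (Ordinal qi); rewrite /= nth_index.
Qed.
End Berge.

(** * Edge-count conditions and the two extremal graphs *)

Lemma pointed_bijection (V : finType) m (x : V) : #|V| = m.+1 ->
  exists2 f : V -> option 'I_m, bijective f & f x = None.
Proof.
move=> cV; pose rank y := cast_ord cV (enum_rank y).
have rankI : injective rank by move=> y z /cast_ord_inj/enum_rank_inj.
exists (fun y => unlift (rank x) (rank y)); last by rewrite unlift_none.
apply: inj_card_bij; last by rewrite card_option card_ord cV.
move=> y z /=; case: unliftP => [j|] yE; case: unliftP => [k|] zE // jk.
  by apply: rankI; rewrite yE zE; case: jk => ->.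
by apply: rankI; rewrite yE zE.
Qed.

Section Extremal.
Variables (V : finType) (r m : nat) (H : uhypergraph r V) (x : V).
Hypothesis cV : #|V| = m.+1.
Local Notation F := (edges H).
Implicit Types e : {set V}.
Hypothesis full : #|avoiding F x| = 'C(m, r).

Lemma edges_card e : e \in F -> #|e| = r.
Proof. by move=> /(subsetP (edges_uniform H)); rewrite inE => /eqP. Qed.

Lemma avoiding_full e : x \notin e -> (e \in F) = (#|e| == r).
Proof.
move=> xe; apply/idP/eqP => [/edges_card//|er].
have cx : #|[set: V] :\ x| = m.
  by have := cardsD1 x [set: V]; rewrite cardsT cV inE => -[].
have : avoiding F x = [set e : {set V} | e \subset [set: V] :\ x & #|e| == r].
  apply/eqP; rewrite eqEcard cards_draws cx full leqnn andbT.
  apply/subsetP => g; rewrite !inE subsetD1 subsetT => /andP[gF ->].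
  by rewrite edges_card //=.
by move/setP/(_ e); rewrite !inE xe andbT subsetD1 subsetT xe er eqxx.
Qed.

Lemma in_complete_plus_vertex (f : V -> option 'I_m) : bijective f ->
  f x = None -> forall e : {set V},
  (f @: e \in edges (complete_plus_vertex r m)) = (x \notin e) && (#|e| == r).
Proof.
move=> /[dup] bf [h fK hK] fx e; have fI := bij_inj bf; apply/imsetP/andP.
  case=> S; rewrite inE => /eqP Sr eS; split.
    apply/negP => xe; have : None \in f @: e by rewrite -fx imset_f.
    by rewrite eS => /imsetP[].
  by rewrite -(card_imset e fI) eS card_imset ?Sr //; apply: Some_inj.
case=> xe /eqP er; have fe : f @: e = Some @: (Some @^-1: (f @: e)).
  apply/setP => o; apply/idP/imsetP => [|[k + ->]]; last by rewrite inE.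
  case: o => [k ke|/imsetP[y ye]]; first by exists k; rewrite ?inE.
  by rewrite -fx => /fI xy; rewrite xy ye in xe.
exists (Some @^-1: (f @: e)) => //.
by rewrite inE -(card_imset _ Some_inj) -fe card_imset ?er.
Qed.

Lemma iso_complete_plus_vertexP : link F x = set0 -> iso_complete_plus_vertex m H.
Proof.
move=> l0; have [f bf fx] := pointed_bijection x cV.
exists f => // e; rewrite in_complete_plus_vertex //.
case: (boolP (x \in e)) => xe /=; last exact: avoiding_full.
by apply/negP => eF; have := in_set0 e; rewrite -l0 inE eF xe.
Qed.

Lemma iso_complete_plus_edgeP e : link F x = [set e] -> iso_complete_plus_edge m H.
Proof.
move=> l1; have [f bf fx] := pointed_bijection x cV.
have : e \in link F x by rewrite l1 inE.
rewrite inE => /andP[eF xe].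
have fI := bij_inj bf.
have er : #|f @: e| = r by rewrite card_imset // edges_card.
exists (f @: e), er; split; first by rewrite -fx imset_f.
exists f => // g; rewrite in_setU1 in_complete_plus_vertex //.
rewrite (inj_eq (imset_inj fI)).
case: (boolP (x \in g)) => xg /=.
  have := l1 => /setP/(_ g); rewrite !inE xg andbT => ->; rewrite orbF //.
rewrite avoiding_full //.
by case: (eqVneq g e) => // ge; rewrite ge xe in xg.
Qed.
End Extremal.

Lemma link_arith1 n r l : 2 < r -> r + 2 <= n ->
  'C(n, r) <= 'C(n.-1, r) + l -> 1 < l.
Proof.
case: n r => [|n] [|r] //= r2 rn; rewrite binS leq_add2l; apply: leq_trans.
by apply: ltn_trans (leq_bin_codim2 r2 _) => //; [apply: ltn_trans r2 | lia].
Qed.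

Lemma link_arith2 n r a l : 2 < r -> r + 2 <= n -> 'C(n.-1, r) <= a.+1 ->
  a <= 'C(n.-2, r) + l -> 1 < l.
Proof.
move=> r2 rn; have n1 : 1 < n by lia.
case: n r n1 r2 rn => [|[|n]] [|r] //= _ r2 rn; rewrite binS => h1 h2.
have : r.+1 <= 'C(n, r) by rewrite -[leqLHS]binSn leq_bin2l //; lia.
lia.
Qed.

Section EdgeConditions.
Variables (V : finType) (r : nat) (H : uhypergraph r V).
Hypotheses (r2 : 2 < r) (rV : r + 2 <= #|V|).
Local Notation F := (edges H).

Let V0 : 0 < #|V|. Proof. by apply: leq_trans rV; rewrite addn2. Qed.
Let cT : #|[set: V]| = #|V|. Proof. exact: cardsT. Qed.
Let FT : {in F, forall e : {set V}, e \subset [set: V]}. Proof. by move=> e _; apply: subsetT. Qed.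
Let Fr : {in F, forall e : {set V}, #|e| = r}. Proof. by move=> e; apply: edges_card. Qed.

(** If x has degree at most one, then at least C(n-1,r) edges avoid x; so all the
    r-sets avoiding x are edges, and exactly one edge contains x. *)
Lemma edges_Berge_cycle : 'C(#|V|.-1, r) < #|F| ->
  ~ iso_complete_plus_edge #|V|.-1 H -> has_Hamiltonian_Berge_cycle H.
Proof.
move=> cF niso; apply: hamiltonian_Berge_cycle => //.
apply: (@uniform_hamiltonian _ _ _ r); rewrite ?cT // => x _.
rewrite ltnNge; apply/negP => lx; apply: niso.
have lo := card_avoiding_uniform (in_setT x) FT Fr; rewrite cT in lo.
have [l1 full] := pendant_arith1 (card_avoiding F x) cF lx lo.
have /eqP/cards1P[e lE] := l1.
by apply: (iso_complete_plus_edgeP (x := x)) lE; rewrite ?prednK.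
Qed.

(** An r-set f is chosen such that with f as an edge there are more than
    C(n-1,r) edges and all degrees are at least two. This is possible unless
    some vertex is isolated: a vertex v of degree one receives f, and then the
    other vertices have large degrees, since at most one r-set avoiding v is
    not an edge. *)
Lemma edges_Berge_path : 'C(#|V|.-1, r) <= #|F| ->
  ~ iso_complete_plus_vertex #|V|.-1 H -> has_Hamiltonian_Berge_path H.
Proof.
move=> cF niso.
suff [f [fr cF1 d1]] : exists f : {set V}, [/\ #|f| = r, 'C(#|V|.-1, r) < #|f |: F| &
    forall x, 1 < #|link (f |: F) x|].
  apply: (@hamiltonian_Berge_path _ _ _ f) => //.
  apply: (@uniform_hamiltonian _ _ _ r); rewrite ?cT // => e.
  by case/setU1P=> [->|/Fr].
have grow f x : #|link F x| <= #|link (f |: F) x|.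
  apply/subset_leq_card/subsetP => e; rewrite !inE => /andP[-> ->].
  by rewrite orbT.
have [/existsP[v lv]|] := boolP [exists v, #|link F v| <= 1]; last first.
  move/existsPn => d2; have {}d2 x : 1 < #|link F x| by rewrite ltnNge.
  have [cF1|cF1] := ltnP 'C(#|V|.-1, r) #|F|.
    have /card_gt0P[f fF] : 0 < #|F| by apply: leq_trans cF1.
    by exists f; rewrite (setUidPr _) ?sub1set // Fr.
  have : ~~ (rsubsets r V \subset F).
    apply/negP => /subset_leq_card; rewrite card_draws leqNgt; case/negP.
    apply: leq_ltn_trans cF1 _; move: r2 rV; case: (r) => // r'; case: #|V| => //= n _ rn.
    by rewrite binS -[ltnLHS]addn0 ltn_add2l bin_gt0; lia.
  case/subsetPn=> f; rewrite inE => /eqP fr fF; exists f; split=> //.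
    by rewrite cardsU1 fF.
  by move=> x; apply: leq_trans (d2 x) (grow f x).
have lo := card_avoiding_uniform (in_setT v) FT Fr; rewrite cT in lo.
have l0 : #|link F v| != 0.
  apply/eqP => l0; apply: niso; apply: (iso_complete_plus_vertexP (x := v)).
  - by rewrite prednK.
  - by apply/eqP; rewrite eqn_leq lo; have := card_avoiding F v; rewrite l0 addn0 => ->.
  - by apply/eqP; rewrite -cards_eq0 l0.
have l1 : #|link F v| = 1 by apply/eqP; rewrite eqn_leq lv lt0n.
have av : 'C(#|V|.-1, r) <= #|avoiding F v|.+1 by rewrite -addn1 -l1 card_avoiding.
have : ~~ (link (rsubsets r V) v \subset link F v).
  apply/negP => /subset_leq_card; rewrite l1 leqNgt; case/negP.
  have Ur : {in rsubsets r V, forall e : {set V}, #|e| = r}.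
    by move=> e; rewrite inE => /eqP.
  have UT : {in rsubsets r V, forall e : {set V}, e \subset [set: V]} by move=> e _; apply: subsetT.
  have := link_lower (in_setT v) UT Ur; rewrite cT card_draws.
  exact: link_arith1.
case/subsetPn=> f; rewrite 2!inE => /andP[/eqP fr vf]; rewrite inE vf andbT => fF.
exists f; split=> // [|x]; first by rewrite cardsU1 fF add1n ltnS.
have [->|xv] := eqVneq x v.
  suff : link F v \proper link (f |: F) v by move/proper_card; rewrite l1.
  apply/properP; split; last by exists f; rewrite !inE ?eqxx // (negbTE fF).
  by apply/subsetP => e; rewrite !inE => /andP[-> ->]; rewrite orbT.
apply: leq_trans (grow f x).
apply: (@leq_trans #|link (avoiding F v) x|); last first.
  by apply/subset_leq_card/subsetP => e; rewrite !inE => /andP[/andP[-> _] ->].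
have xA : x \in [set: V] :\ v by rewrite !inE xv.
have Ar : {in avoiding F v, forall e : {set V}, #|e| = r}.
  by move=> e /(subsetP (avoidingS F v)); apply: Fr.
have := link_lower xA (avoiding_sub FT) Ar.
have -> : #|[set: V] :\ v| = #|V|.-1 by rewrite -cT (cardsD1 v [set: V]) inE.
exact: link_arith2 av.
Qed.
End EdgeConditions.

From mathcomp Require Import all_order all_algebra.
From mathcomp Require Import all_classical all_reals all_analysis ring lra.
Import Order.TTheory GRing.Theory Num.Theory.
Local Open Scope ring_scope.

(** * Entropy of exchangeable pairs *)

Section Entropy.
Variable R : realType.
Implicit Types (x y : R).

(** This is ln t <= t - 1 at t = y / x. It persists at x = 0 because x * ln x
    vanishes there. *)
Lemma relative_entropy_ge x y : 0 <= x -> 0 <= y -> (0 < x -> 0 < y) ->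
  x - y <= x * (ln x - ln y).
Proof.
rewrite le_eqVlt => /orP[/eqP<- y0 _|x0 y0 /(_ x0) {}y0].
  by rewrite mul0r sub0r oppr_le0.
rewrite -ln_div ?posrE // -[ln _]opprK -lnV ?posrE ?divr_gt0 // invf_div.
have := @le_ln1Dx R (y / x - 1); rewrite subrKC ltrBrDr addNr divr_gt0 // => /(_ isT).
move=> h; rewrite mulrN lerNr opprB -ler_pdivlMl //; apply: le_trans h _.
by rewrite mulrBr mulVf ?gt_eqF // mulrC.
Qed.

Definition xlnx x := x * ln x.

(** Nonnegativity of the relative entropy of c with respect to the product
    measure u, w |-> b u * b w / a, which has the same total mass N^2 a and, up
    to the factor N, the same marginals b. *)
Lemma pair_entropy (T : finType) (P : pred T) (a N : R) (b : T -> R) (c : T -> T -> R) :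
    0 <= a -> (forall u, P u -> 0 <= b u) -> (forall u w, P u -> P w -> 0 <= c u w) ->
    (forall u w, c u w = c w u) ->
    \sum_(u | P u) b u = N * a ->
    (forall u, P u -> \sum_(w | P w) c u w = N * b u) ->
  0 <= N ^+ 2 * xlnx a - N * (\sum_(u | P u) xlnx (b u)) *+ 2 +
    \sum_(u | P u) \sum_(w | P w) xlnx (c u w).
Proof.
move=> a0 b0 c0 cC sb sc.
have pos0 (Q : pred T) (h : T -> R) s : (forall u, Q u -> 0 <= h u) ->
    \sum_(u | Q u) h u = N * s -> s = 0 -> forall u, Q u -> h u = 0.
  by move=> h0 hs s0; rewrite s0 mulr0 in hs; apply: psumr_eq0P hs.
have bz u w : P u -> P w -> 0 < c u w -> 0 < b u.
  move=> Pu Pw cuw; rewrite lt_def b0 // andbT; apply: contraTneq cuw => bu.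
  by rewrite (pos0 _ _ _ (fun w => c0 u w Pu) (sc u Pu) bu) // ltxx.
have az u : P u -> 0 < b u -> 0 < a.
  move=> Pu bu; rewrite lt_def a0 // andbT; apply: contraTneq bu => a1.
  by rewrite (pos0 _ _ _ b0 sb a1) // ltxx.
have key u w : P u -> P w -> c u w - b u * b w / a <=
    c u w * ln (c u w) + c u w * ln a - c u w * ln (b u) - c u w * ln (b w).
  move=> Pu Pw.
  have [c1|] := ltP 0 (c u w); last first.
    move=> c1; have -> : c u w = 0 by apply/le_anti; rewrite c1 c0.
    by rewrite !mul0r !subr0 addr0 sub0r oppr_le0 divr_ge0 ?mulr_ge0 ?b0.
  have bu := bz u w Pu Pw c1.
  have bw : 0 < b w by apply: (bz w u) => //; rewrite cC.
  have a1 := az u Pu bu.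
  apply: le_trans (relative_entropy_ge (ltW c1) _ _) _; first by rewrite divr_ge0 ?mulr_ge0 ?ltW.
    by rewrite divr_gt0 ?mulr_gt0.
  rewrite ln_div ?posrE ?mulr_gt0 // lnM ?posrE //.
  by rewrite le_eqVlt; apply/orP; left; apply/eqP; ring.
have : \sum_(u | P u) \sum_(w | P w) (c u w - b u * b w / a) <=
  \sum_(u | P u) \sum_(w | P w)
    (c u w * ln (c u w) + c u w * ln a - c u w * ln (b u) - c u w * ln (b w)).
  by apply: ler_sum => u Pu; apply: ler_sum => w Pw; apply: key.
have scc : \sum_(u | P u) \sum_(w | P w) c u w = N ^+ 2 * a.
  by rewrite (eq_bigr (fun u => N * b u)) // -mulr_sumr sb mulrA.
have -> : \sum_(u | P u) \sum_(w | P w) (c u w - b u * b w / a) = 0.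
  under eq_bigr do rewrite sumrB; rewrite sumrB scc.
  rewrite (eq_bigr (fun u => b u * (N * a / a))); last first.
    by move=> u Pu; rewrite -sb mulr_suml mulr_sumr; apply: eq_bigr => w _; rewrite mulrA.
  rewrite -mulr_suml sb; have [->|a1] := eqVneq a 0; first by rewrite !mulr0 mul0r subrr.
  by rewrite mulfK // expr2; ring.
move/le_trans; apply.
have e1 : \sum_(u | P u) \sum_(w | P w) c u w * ln (b u) = N * \sum_(u | P u) xlnx (b u).
  rewrite mulr_sumr; apply: eq_bigr => u Pu; rewrite -mulr_suml sc //.
  by rewrite /xlnx mulrA.
have e2 : \sum_(u | P u) \sum_(w | P w) c u w * ln (b w) = N * \sum_(u | P u) xlnx (b u).
  rewrite exchange_big /= -e1; apply: eq_bigr => u Pu; apply: eq_bigr => w Pw.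
  by rewrite cC.
under eq_bigr do rewrite !(sumrB, big_split) /=.
rewrite !(sumrB, big_split) /= e1 e2.
have -> : \sum_(u | P u) \sum_(w | P w) c u w * ln a = N ^+ 2 * xlnx a.
  by under eq_bigr do rewrite -mulr_suml; rewrite -mulr_suml scc /xlnx mulrA.
by rewrite /xlnx le_eqVlt; apply/orP; left; apply/eqP; ring.
Qed.
End Entropy.

(** * Entropy profile of a weighted family *)

Section UpperSums.
Variables (R : realType) (V : finType).
Implicit Types (psi : {set V} -> R) (S T : {set V}).

(** Iterated i times from the empty set, this sums over all the ordered i-tuples
    of distinct points, each contributing the value at its underlying set. *)
Definition upper_sum psi S := \sum_(u | u \notin S) psi (u |: S)%SET.

Lemma upper_sum_lin (a b c : R) psi1 psi2 psi3 S :
  upper_sum (fun T => a * psi1 T + b * psi2 T + c * psi3 T) S =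
  a * upper_sum psi1 S + b * upper_sum psi2 S + c * upper_sum psi3 S.
Proof. by rewrite /upper_sum !mulr_sumr -!big_split. Qed.

Lemma iter_upper_sum_lin i (a b c : R) psi1 psi2 psi3 S :
  iter i upper_sum (fun T => a * psi1 T + b * psi2 T + c * psi3 T) S =
  a * iter i upper_sum psi1 S + b * iter i upper_sum psi2 S + c * iter i upper_sum psi3 S.
Proof.
elim: i S => [//|i IH] S /=; rewrite -upper_sum_lin /upper_sum.
by apply: eq_bigr => u _.
Qed.

Lemma iter_upper_sum_ge0 i psi S :
  (forall T, #|T| = (#|S| + i)%N -> 0 <= psi T) -> 0 <= iter i upper_sum psi S.
Proof.
elim: i S => [|i IH] S psi0 /=; first by apply: psi0; rewrite addn0.
apply: sumr_ge0 => u uS; apply: IH => T cT; apply: psi0.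
by rewrite cT cardsU1 uS add1n addSnnS.
Qed.

(** A superset T of S is counted once for each of the |T| - |S| points of T
    outside S. *)
Lemma upper_sum_supersets (Q : pred {set V}) psi S :
  \sum_(u | u \notin S) \sum_(T | Q T && (u |: S \subset T)%SET) psi T =
  \sum_(T | Q T && (S \subset T)%SET) (#|T| - #|S|)%:R * psi T.
Proof.
rewrite (exchange_big_dep (fun T => Q T && (S \subset T)%SET)) /=; last first.
  by move=> u T _ /andP[-> /(fintype.subset_trans (finset.subsetUr _ _)) ->].
apply: eq_bigr => T /andP[QT ST]; rewrite sumr_const mulr_natl.
congr (_ *+ _); rewrite -cardsDS //.
apply: eq_card => u; rewrite [LHS]/in_mem /= QT finset.in_setD; congr (_ && _).
by rewrite finset.subUset finset.sub1set ST andbT.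
Qed.

Lemma iter_upper_sum_sum i psi S : iter i upper_sum psi S =
  i`!%:R * \sum_(T : {set V} | (#|T| == #|S| + i)%N && (S \subset T)%SET) psi T.
Proof.
elim: i S => [|i IH] S.
  rewrite mul1r (big_pred1 S) //= => T; rewrite addn0 eq_sym -[RHS]eq_sym.
  by rewrite eqEcard andbC; apply: andb_id2l => ST; rewrite eqn_leq subset_leq_card ?andbT.
rewrite iterS /upper_sum; under eq_bigr => u uS do rewrite IH cardsU1 uS add1n addSnnS.
rewrite -mulr_sumr upper_sum_supersets factS natrM -mulrA [RHS]mulrCA; congr (_ * _).
rewrite mulr_sumr; apply: eq_bigr => T /andP[/eqP cT _].
by rewrite cT addKn.
Qed.

Variables (f : {set V} -> R) (n r : nat).
Hypothesis rn : (r <= n)%N.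
Hypothesis f0 : forall S, 0 <= f S.
Hypothesis f1 : f finset.set0 = 1.
Hypothesis fup : forall S, (#|S| < r)%N -> upper_sum f S = (n - #|S|)%:R * f S.

Local Notation phi := (fun S => xlnx (f S)).
Local Notation b i := (iter i upper_sum phi finset.set0).

(** [pair_entropy] at every S of size i, with b u = f (u + S) and
    c u w = f (u + w + S). For u = w the latter is f (u + S) again; these
    diagonal terms raise the row sums of c from (N - 1) b u to N b u. *)
Lemma entropy_concave i : (i + 2 <= r)%N ->
  0 <= (n - i)%:R ^+ 2 * b i - (n - i)%:R * b i.+1 *+ 2 + b i.+1 + b i.+2.
Proof.
move=> ir; set N : R := (n - i)%:R.
have -> : N ^+ 2 * b i - N * b i.+1 *+ 2 + b i.+1 + b i.+2 =
    iter i upper_sum (fun S => N ^+ 2 * phi S + (1 - N *+ 2) * upper_sum phi S +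
      1 * upper_sum (upper_sum phi) S) finset.set0.
  by rewrite iter_upper_sum_lin -!iterSr; ring.
apply: iter_upper_sum_ge0 => S; rewrite cards0 add0n => cS.
have Sr : (#|S| < r)%N by rewrite cS -addn1 (leq_trans _ ir) // leq_add2l.
pose bb u := f (u |: S)%SET.
pose c u w := f (w |: (u |: S))%SET.
have cE u : u \notin S -> forall h : R -> R,
    \sum_(w | w \notin S) h (c u w) = h (bb u) + \sum_(w | w \notin (u |: S)%SET) h (c u w).
  move=> uS h; rewrite (bigD1 u) //=; congr (h _ + _).
    by rewrite /c finset.setUA finset.setUid.
  by apply: eq_bigl => w; rewrite !inE negb_or andbC.
have := @pair_entropy R V (fun u => u \notin S) (f S) N bb c (f0 S).
have -> : \sum_(u | u \notin S) xlnx (bb u) = upper_sum phi S by [].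
have -> : \sum_(u | u \notin S) \sum_(w | w \notin S) xlnx (c u w) =
    upper_sum phi S + upper_sum (upper_sum phi) S.
  by rewrite -big_split; apply: eq_bigr => u uS; rewrite cE.
move=> h; apply: le_trans (h _ _ _ _ _) _.
- by move=> u _; apply: f0.
- by move=> u w _ _; apply: f0.
- by move=> u w; rewrite /c finset.setUCA.
- by rewrite -[LHS]/(upper_sum f S) fup // cS.
- move=> u uS; rewrite (cE u uS id) -[X in _ + X]/(upper_sum f (u |: S)%SET).
  have iS : (i.+1 < r)%N by move: ir; rewrite addn2.
  rewrite fup cardsU1 uS cS add1n // /N -(@subnSK i n); last first.
    by apply: leq_trans rn; apply: ltnW.
  by rewrite -[in RHS]add1n natrD mulrDl mul1r.
- by rewrite le_eqVlt; apply/orP; left; apply/eqP; ring.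
Qed.
End UpperSums.

Section Numeric.
Variable R : realType.

(** Put N_i = n - i and c_i = N_i b_i - b_(i+1). The inequalities say that
    c_(i+1) <= N_i c_i, and c_0 = - b_1 is negative; so every c_i is negative,
    and b_(i+1) > N_i b_i can be iterated from b_1 up to b_r. *)
Lemma concave_chain (n r : nat) (b : nat -> R) : (1 < r)%N -> (r <= n)%N -> b 0%N = 0 ->
    (forall i, (i + 2 <= r)%N ->
      0 <= (n - i)%:R ^+ 2 * b i - (n - i)%:R * b i.+1 *+ 2 + b i.+1 + b i.+2) ->
  0 < b 1%N -> (n.-1 ^_ r.-1)%:R * b 1%N < b r.
Proof.
move=> r1 rn b0 conc b1.
have step i : (i < r)%N -> (n - i)%:R * b i < b i.+1.
  elim: i => [_|i IH ir]; first by rewrite b0 mulr0.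
  have := conc i; rewrite addn2 => /(_ ir) cv; have {}IH := IH (ltnW ir).
  have Ni : (n - i)%:R = (n - i.+1)%:R + 1 :> R.
    by rewrite natr1 subnSK // (leq_trans (ltnW ir)).
  have N0 : 0 <= (n - i.+1)%:R :> R by [].
  move: Ni N0 cv IH; move: (n - i)%:R (n - i.+1)%:R => N M -> M0 cv IH.
  have : 0 < (M + 1) * (b i.+1 - (M + 1) * b i) by rewrite mulr_gt0 ?subr_gt0 //; lra.
  lra.
have chain i : (i.+1 < r)%N -> (n.-1 ^_ i.+1)%:R * b 1%N < b i.+2.
  elim: i => [r2|i IH ir].
    by rewrite ffactn1 -subn1; apply: step.
  rewrite ffactnSr natrM.
  apply: le_lt_trans (step _ ir); rewrite [X in X * _]mulrC -mulrA.
  have -> : (n.-1 - i.+1 = n - i.+2)%N by rewrite -subn1 -subnDA add1n.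
  by rewrite ler_wpM2l // ltW // IH // ltnW.
by case: r r1 {rn conc step} chain => [|[|r]] // _ /(_ r); apply.
Qed.
End Numeric.

(** * The spectral radius bounds the number of edges *)

Lemma ln_prod (R : realType) (I : finType) (P : pred I) (x : I -> R) :
  (forall i, P i -> 0 < x i) ->
  ln (\prod_(i | P i) x i) = \sum_(i | P i) ln (x i).
Proof.
move=> x0; suff [] : 0 < \prod_(i | P i) x i /\
  ln (\prod_(i | P i) x i) = \sum_(i | P i) ln (x i) by [].
apply: (big_ind2 (fun p s => 0 < p /\ ln p = s)) => [|p s q t [p0 <-] [q0 <-]|i Pi].
- by rewrite ltr01 ln1.
- by rewrite mulr_gt0 // lnM ?posrE.
- by rewrite x0.
Qed.

Section Spectral.
Variables (R : realType) (V : finType) (r n : nat) (F : {set {set V}}) (x : V -> R).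
Hypotheses (r1 : (1 < r)%N) (rn : (r <= n)%N).
Hypothesis Fr : {in F, forall e : {set V}, #|e| = r}.
Hypothesis x0 : forall v, 0 <= x v.
Hypothesis xr : \sum_v x v ^+ r = 1.

Let w (e : {set V}) : R := \prod_(v in e) x v.
Let M : R := \sum_(e in F) w e.
Let m (S : {set V}) : R := \sum_(e : {set V} | (e \in F) && (S \subset e)) w e.
(* The weighted degree of S, scaled to be 1 for every S when F is the family of all
   r-subsets of n points, all of the same weight. *)
Let f (S : {set V}) : R := m S / M * ((n ^_ #|S|)%:R / (r ^_ #|S|)%:R).
Let C1 : R := 'C(n.-1, r.-1)%:R.
Let lam : R := r%:R * M.

Hypothesis lamC : C1 <= lam.

Local Notation b i := (iter i (@upper_sum R V) (fun S => xlnx (f S)) finset.set0).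

Let w0 e : 0 <= w e. Proof. by apply: prodr_ge0. Qed.
Let n0 : (0 < n)%N. Proof. by apply: leq_trans rn; apply: ltnW. Qed.
Let C10 : 0 < C1.
Proof. by rewrite ltr0n bin_gt0 -ltnS !prednK // ltnW. Qed.
Let M0 : 0 < M.
Proof. by have := lt_le_trans C10 lamC; rewrite pmulr_rgt0 // ltr0n ltnW. Qed.

Let f0 S : 0 <= f S.
Proof.
by rewrite mulr_ge0 // divr_ge0 ?(ltW M0) //; apply: sumr_ge0 => e _; apply: w0.
Qed.

Let m0 : m finset.set0 = M.
Proof. by apply: eq_bigl => e; rewrite finset.sub0set andbT. Qed.

Let f1 : f finset.set0 = 1.
Proof. by rewrite /f m0 cards0 !ffactn0 !divff ?gt_eqF // mulr1. Qed.

Let fup (S : {set V}) : (#|S| < r)%N -> upper_sum f S = (n - #|S|)%:R * f S.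
Proof.
move=> Sr; have -> : upper_sum f S = (\sum_(u | u \notin S) m (u |: S)%SET) / M *
    ((n ^_ #|S|.+1)%:R / (r ^_ #|S|.+1)%:R).
  by rewrite mulr_suml mulr_suml; apply: eq_bigr => u uS; rewrite /f cardsU1 uS.
have -> : \sum_(u | u \notin S) m (u |: S)%SET = (r - #|S|)%:R * m S.
  rewrite [LHS](@upper_sum_supersets R V (fun e => e \in F)) mulr_sumr.
  by apply: eq_bigr => e /andP[eF _]; rewrite Fr.
rewrite /f !ffactnSr !natrM invfM.
have rS : (r - #|S|)%:R != 0 :> R by rewrite pnatr_eq0 subn_eq0 -ltnNge.
have -> : (r - #|S|)%:R * m S / M *
    ((n ^_ #|S|)%:R * (n - #|S|)%:R * ((r ^_ #|S|)%:R^-1 * (r - #|S|)%:R^-1)) =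
  ((r - #|S|)%:R / (r - #|S|)%:R) * ((n - #|S|)%:R *
    (m S / M * ((n ^_ #|S|)%:R / (r ^_ #|S|)%:R))) by ring.
by rewrite divff // mul1r.
Qed.

Let K : R := 'C(n, r)%:R.
Let K0 : 0 < K. Proof. by rewrite ltr0n bin_gt0. Qed.

Let fE e : e \in F -> f e = w e * K / M.
Proof.
move=> eF; rewrite /f Fr // ffactnn -bin_ffact natrM mulfK; last first.
  by rewrite pnatr_eq0 -lt0n fact_gt0.
rewrite (_ : m e = w e); first by rewrite mulrAC.
rewrite /m (big_pred1 e) // => g /=; apply/andP/eqP => [[gF eg]|->//].
by apply/esym/eqP; rewrite eqEcard eg !Fr ?leqnn.
Qed.

Let brE : b r = r`!%:R * \sum_(e in F) xlnx (f e).
Proof.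
rewrite iter_upper_sum_sum cards0 add0n; congr (_ * _).
rewrite big_mkcond [RHS]big_mkcond /=; apply: eq_bigr => e _.
rewrite finset.sub0set andbT; case: ifP => [/eqP er|er].
  case: ifP => // eF; rewrite /f (_ : m e = 0) ?mul0r /xlnx ?mul0r //.
  apply: big_pred0 => g; apply/negbTE/negP => /andP[gF eg].
  have /eqP ge : e == g by rewrite eqEcard eg er Fr /=.
  by rewrite ge gF in eF.
by case: ifP => // eF; rewrite Fr // eqxx in er.
Qed.

Let b1E : b 1%N = \sum_v xlnx (f [set v]%SET).
Proof.
rewrite /= /upper_sum; apply: eq_big => v; first by rewrite finset.inE.
by rewrite finset.setU0.
Qed.

Let sumfe : \sum_(e in F) f e = K.
Proof.
rewrite (eq_bigr (fun e => w e * (K / M))); last by move=> e /fE ->; rewrite mulrA.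
by rewrite -mulr_suml -/M mulrC mulfVK ?gt_eqF.
Qed.

Let sumfv : \sum_v f [set v]%SET = n%:R.
Proof.
have := @fup finset.set0; rewrite cards0 f1 subn0 mulr1 => <-; last exact: ltnW.
by apply: eq_big => v; rewrite ?finset.inE ?finset.setU0.
Qed.

(** Relative entropy of f on F with respect to the constant K / |F|. *)
Let edge_entropy : K * ln (K / #|F|%:R) <= \sum_(e in F) xlnx (f e).
Proof.
have F0 : (0 < #|F|)%N.
  rewrite lt0n; apply: contraTneq M0 => /eqP; rewrite cards_eq0 => /eqP F0.
  by rewrite /M F0 big_set0 ltxx.
have : \sum_(e in F) (f e - K / #|F|%:R) <=
    \sum_(e in F) f e * (ln (f e) - ln (K / #|F|%:R)).
  apply: ler_sum => e eF; apply: relative_entropy_ge => //.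
    by rewrite divr_ge0 // ltW.
  by move=> _; rewrite divr_gt0 // ltr0n.
rewrite sumrB sumfe sumr_const -(mulr_natr (K / #|F|%:R)) mulfVK ?pnatr_eq0 -?lt0n // subrr.
under eq_bigr do rewrite mulrBr; rewrite sumrB -mulr_suml sumfe subr_ge0.
by [].
Qed.

(** On an edge, f e is n C1 / lam times the product of the x v, so its logarithm
    splits over the vertices of e. The resulting sum is bounded through the
    relative entropy of v |-> f v with respect to v |-> n (x v)^r. *)
Let vertex_entropy : \sum_(e in F) xlnx (f e) <=
  K * ln (C1 / lam) + K / n%:R * b 1%N.
Proof.
rewrite b1E; have nR : n%:R != 0 :> R by rewrite pnatr_eq0 -lt0n.
have nR0 : 0 < n%:R :> R by rewrite ltr0n.
have lam0 : 0 < lam by exact: lt_le_trans lamC.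
have rR : r%:R != 0 :> R by rewrite pnatr_eq0 -lt0n ltnW.
have KC : r%:R * K = n%:R * C1.
  by rewrite -!natrM mul_bin_diag prednK // ltnW.
have ef e : e \in F -> xlnx (f e) =
    f e * (ln (C1 / lam) + ln n%:R) + f e * \sum_(v in e) ln (x v).
  move=> eF; rewrite /xlnx -mulrDr; have [fe|fe] := eqVneq (f e) 0.
    by rewrite fe !mul0r.
  congr (_ * _).
  have we : 0 < w e.
    by rewrite lt_def w0 andbT; apply: contraNneq fe; rewrite fE // => ->; rewrite !mul0r.
  have xe v : v \in e -> 0 < x v.
    move=> ve; rewrite lt_def x0 andbT; apply: contraTneq we => xv.
    by rewrite /w (bigD1 v) //= xv mul0r ltxx.
  rewrite -ln_prod // -/(w e) -!lnM ?posrE ?mulr_gt0 ?invr_gt0 //; congr (ln _).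
  rewrite fE // /lam; have Mn : M != 0 by rewrite gt_eqF.
  have -> : K = n%:R * C1 / r%:R by rewrite -KC mulrC mulKf.
  by field; rewrite rR Mn.
rewrite (eq_bigr _ ef) big_split /= -mulr_suml sumfe mulrDr -addrA lerD2l.
have fvE v : f [set v]%SET = m [set v]%SET / M * (n%:R / r%:R).
  by rewrite /f cards1 !ffactn1.
have fv0 v : x v = 0 -> f [set v]%SET = 0.
  move=> xv; rewrite fvE (_ : m _ = 0) ?mul0r //; apply: big1 => e.
  by rewrite finset.sub1set => /andP[_ ve]; rewrite /w (bigD1 v) //= xv mul0r.
have -> : \sum_(e in F) f e * \sum_(v in e) ln (x v) =
    K / n%:R * \sum_v f [set v]%SET * ln (x v ^+ r).
  under eq_bigr do rewrite mulr_sumr.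
  rewrite (exchange_big_dep predT) //= mulr_sumr; apply: eq_bigr => v _.
  rewrite -mulr_suml mulrA.
  have -> : \sum_(e in F | v \in e) f e = K * m [set v]%SET / M.
    rewrite (eq_bigr (fun e => w e * (K / M))); last first.
      by move=> e /andP[/fE -> _]; rewrite mulrA.
    rewrite -mulr_suml mulrCA mulrA; congr (_ * _ / _).
    by apply: eq_bigl => e; rewrite finset.sub1set.
  have [xv|xv] := eqVneq (x v) 0.
    have /eqP := fv0 v xv; rewrite fvE mulf_eq0 => /orP[/eqP mv|].
      by rewrite -[K * _ / M]mulrA mv !(mulr0, mul0r).
    by rewrite mulf_eq0 invr_eq0 (negbTE nR) (negbTE rR).
  rewrite lnXn ?lt_def ?xv ?x0 // fvE -[ln (x v) *+ r]mulr_natr.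
  by field; rewrite rR nR gt_eqF.
rewrite -[X in X * ln n%:R](mulfVK nR) -[_ * n%:R * ln _]mulrA -mulrDr.
apply: ler_wpM2l; first by rewrite divr_ge0 ?ltW.
have xpos v : 0 < f [set v]%SET -> 0 < x v ^+ r.
  move=> fv; apply: exprn_gt0; rewrite lt_def x0 andbT.
  by apply: contraTneq fv => /fv0 ->; rewrite ltxx.
have : \sum_v (f [set v]%SET - n%:R * x v ^+ r) <=
    \sum_v f [set v]%SET * (ln (f [set v]%SET) - ln (n%:R * x v ^+ r)).
  apply: ler_sum => v _; apply: relative_entropy_ge => //.
    by rewrite mulr_ge0 // exprn_ge0.
  by move/xpos => xv; rewrite mulr_gt0.
rewrite sumrB sumfv -mulr_sumr xr mulr1 subrr.
have -> : \sum_v f [set v]%SET * (ln (f [set v]%SET) - ln (n%:R * x v ^+ r)) =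
    \sum_v xlnx (f [set v]%SET) -
      (n%:R * ln n%:R + \sum_v f [set v]%SET * ln (x v ^+ r)).
  rewrite -[X in X * ln _]sumfv mulr_suml -big_split -sumrB; apply: eq_bigr => v _ /=.
  have := f0 [set v]%SET; rewrite le_eqVlt => /orP[/eqP <-|fv].
    by rewrite /xlnx !mul0r addr0 subr0.
  by rewrite lnM ?posrE ?xpos // /xlnx; ring.
by rewrite subr_ge0.
Qed.

(** If b 1 were positive, [concave_chain] would make b r larger than
    [vertex_entropy] permits. So b 1 <= 0, and the two bounds for the entropy
    over the edges give K / |F| <= C1 / lam. *)
Lemma spectral_card : K * lam <= C1 * #|F|%:R.
Proof.
have lam0 : 0 < lam by exact: lt_le_trans lamC.
have F0 : (0 < #|F|)%N.
  rewrite lt0n; apply: contraTneq M0 => /eqP; rewrite cards_eq0 => /eqP F0.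
  by rewrite /M F0 big_set0 ltxx.
have FR : 0 < #|F|%:R :> R by rewrite ltr0n.
suff : ln (K / #|F|%:R) <= ln (C1 / lam).
  rewrite ler_ln ?posrE ?divr_gt0 //.
  by rewrite ler_pdivrMr // mulrAC ler_pdivlMr.
have lnC : ln (C1 / lam) <= 0 by apply: ln_le0; rewrite ler_pdivrMr ?mul1r.
rewrite -(ler_pM2l K0); apply: le_trans edge_entropy _; apply: le_trans vertex_entropy _.
rewrite gerDl; suff : b 1%N <= 0 by move=> ?; rewrite pmulr_rle0 // divr_gt0 // ltr0n.
rewrite leNgt; apply/negP => b1.
have b0 : b 0%N = 0 by rewrite /= f1 /xlnx mul1r ln1.
have conc i : (i + 2 <= r)%N ->
  0 <= (n - i)%:R ^+ 2 * b i - (n - i)%:R * b i.+1 *+ 2 + b i.+1 + b i.+2.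
  by move=> ir; apply: (@entropy_concave R V f n r).
have := @concave_chain R n r (fun i => b i) r1 rn b0 conc b1.
rewrite ltNge => /negP; apply; rewrite brE.
apply: (@le_trans _ _ (r`!%:R * (K / n%:R * b 1%N))).
  apply: ler_wpM2l => //; apply: le_trans vertex_entropy _.
  by rewrite gerDr pmulr_rle0.
rewrite !mulrA le_eqVlt; apply/orP; left; apply/eqP; congr (_ * _).
have -> : r`!%:R * K = (n ^_ r)%:R by rewrite -natrM mulnC bin_ffact.
case: (n) n0 (r) r1 => // n' _ [|r'] // _.
by rewrite ffactnS natrM [_ * (n' ^_ r')%:R]mulrC mulfK ?pnatr_eq0.
Qed.
End Spectral.

(** The maximizer is replaced by its absolute value, which has the same norm and
    does not decrease the polynomial; [spectral_card] is applied with |V| - 1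
    for n. *)
Lemma spectral_radius_card (R : realType) (r : nat) (V : finType)
    (H : uhypergraph r V) : (1 < r)%N -> (r < #|V|)%N ->
  'C(#|V|.-2, r.-1)%:R <= spectral_radius R H ->
  'C(#|V|.-1, r)%:R * spectral_radius R H <=
    'C(#|V|.-2, r.-1)%:R * #|edges H|%:R.
Proof.
move=> r1 rV; have r0 : (0 < r)%N by apply: ltnW.
have V0 : (0 < #|V|)%N by apply: leq_ltn_trans rV.
have [x x1 [-> _]] := spectral_radius_max R H r0 V0.
have /(lr_norm_eq1 _ r0) {}x1 := x1.
set lam := lagrangian_poly H x => lamC.
have lam_abs : lam <= r%:R * \sum_(e in edges H) \prod_(v in e) `|x v|.
  apply: ler_wpM2l => //; apply: ler_sum => e _.
  by rewrite -normr_prod ler_norm.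
apply: le_trans (ler_wpM2l _ lam_abs) _ => //.
have rn : (r <= #|V|.-1)%N by rewrite -ltnS prednK.
apply: (@spectral_card R V r #|V|.-1 (edges H) (fun v => `|x v|)) => //.
  by move=> e; apply: edges_card.
exact: le_trans lam_abs.
Qed.

Theorem theorem2 (R : realType) (r n : nat) (V : finType) (H : uhypergraph r V)
    (hr : (3 <= r)%N) (hn : (r + 2 <= n)%N) (hV : #|V| = n) :
  ('C(n - 2, r - 1)%:R <= spectral_radius R H ->
     ~ iso_complete_plus_vertex (n - 1)%N H -> has_Hamiltonian_Berge_path H) /\
  ('C(n - 2, r - 1)%:R < spectral_radius R H ->
     ~ iso_complete_plus_edge (n - 1)%N H -> has_Hamiltonian_Berge_cycle H).
Proof.
have r1 : (1 < r)%N by apply: ltnW.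
have rV : (r < #|V|)%N by rewrite hV (leq_trans _ hn) // addn2 ltnS leqnSn.
have rV2 : (r + 2 <= #|V|)%N by rewrite hV.
have card := @spectral_radius_card R r V H r1 rV.
have K0 : 0 < 'C(#|V|.-1, r)%:R :> R.
  by rewrite ltr0n bin_gt0 -ltnS prednK // (leq_ltn_trans _ rV).
have C0 : 0 < 'C(#|V|.-2, r.-1)%:R :> R.
  rewrite ltr0n bin_gt0 -[r.-1]subn1 -[#|V|.-2]subn1 leq_sub2r //.
  by rewrite -ltnS prednK // (leq_ltn_trans _ rV).
rewrite -hV !subn1 subn2; split => lam niso.
  apply: edges_Berge_path => //.
  have := card lam; rewrite -(ler_nat R) -(ler_pM2l C0); apply: le_trans.
  by rewrite mulrC ler_pM2l.
apply: edges_Berge_cycle => //.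
have := card (ltW lam); rewrite -(ltr_nat R) -(ltr_pM2l C0); apply: lt_le_trans.
by rewrite mulrC ltr_pM2l.
Qed.
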